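(* Let $\Omega=(a,b)$, let $\alpha,\beta\in\mathbb{R}$ and let $f$ be analytic on $\overline{\Omega}$. For $0<\epsilon\le 1$ let $U=U_\epsilon$ be the exact solution of $$-\epsilon^2u''+u=f\ \text{ in }\Omega,\qquad u(a)=\alpha,\quad u(b)=\beta,$$ and for an integer $W\ge 2$ let $z\in\mathcal{S}^W(\Omega)$ minimize $$\mathcal{R}_p^W(u)=\|-\epsilon^2u''+u-f\|_{L^2(\Omega)}^2+|u(a)-\alpha|^2+|u(b)-\beta|^2$$ over all $u\in\mathcal{S}^W(\Omega)$. Then there exists a constant $C$, independent of $\epsilon$ and $W$, such that $$\|z-U\|_{2,\epsilon,\Omega}^2\le C\,\frac{\sqrt{\log W}}{W}$$ provided $W+\tfrac12>\tfrac{e}{2\epsilon}$.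
   Context: $\Omega=(a,b)$ is a bounded open interval. In this single-element ($p$-version) setting, $\mathcal{S}^W(\Omega)$ is the space of polynomials of degree at most $W$ on $\Omega$. The parameter-dependent norm is $$\|u\|_{2,\epsilon,\Omega}^2=\sum_{j=0}^{2}\epsilon^{2j}\left\|\frac{d^ju}{dx^j}\right\|_{L^2(\Omega)}^2 .$$ The constant $C$ may depend on $f,\alpha,\beta$ and $\Omega$. Here $e=\exp(1)$. *)

(* Defs.v *)
From HB Require Import structures.
From mathcomp Require Export all_boot all_order all_algebra.
From mathcomp Require Export all_classical all_reals all_analysis.

Set Implicit Arguments.
Unset Strict Implicit.
Unset Printing Implicit Defensive.

Export Order.TTheory GRing.Theory Num.Theory.
Export numFieldNormedType.Exports.

Local Open Scope classical_set_scope.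
Local Open Scope ring_scope.

Definition analytic_at (R : realType) (f : R -> R) (c : R) : Prop :=
  exists a : R^nat, \forall x \near c, pseries a (x - c) @ \oo --> f x.

(* On a closed interval this asks for convergence on a two-sided neighbourhood
   of every point, endpoints included: f is analytic across the boundary. *)
Definition analytic_on (R : realType) (D : set R) (f : R -> R) : Prop :=
  forall c, D c -> analytic_at f c.

(* The norms are taken over the open interval, so values of u and of its
   (total) derivatives at and beyond the endpoints do not matter. *)
Definition L2norm (R : realType) (a b : R) (u : R -> R) : \bar R :=
  ('N[lebesgue_measure]_2%:E [(EFin \o u) \_ `]a, b[])%E.

Definition norm2eps_sq (R : realType) (a b eps : R) (u : R -> R) : \bar R :=
  (\sum_(j < 3) (eps ^+ (2 * j))%:E * L2norm a b (derive1n j u) ^+ 2)%E.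

(* Classical solution: continuous up to the boundary, twice differentiable
   inside. *)
Definition exact_solution (R : realType) (a b alpha beta eps : R)
    (f u : R -> R) : Prop :=
  [/\ {within `[a, b], continuous u},
      (forall x, x \in `]a, b[ ->
        [/\ derivable u x 1, derivable (derive1 u) x 1
          & - eps ^+ 2 * derive1n 2 u x + u x = f x]),
      u a = alpha
    & u b = beta].

Definition residual (R : realType) (a b alpha beta eps : R)
    (f u : R -> R) : \bar R :=
  (L2norm a b (fun x => - eps ^+ 2 * derive1n 2 u x + u x - f x)%R ^+ 2
   + (`|u a - alpha|%R ^+ 2)%:E + (`|u b - beta|%R ^+ 2)%:E)%E.

Definition poly_space (R : realType) (W : nat) : set {poly R} :=
  [set p : {poly R} | (size p <= W.+1)%N].

Definition minimizes_residual (R : realType) (a b alpha beta eps : R)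
    (f : R -> R) (W : nat) (z : {poly R}) : Prop :=
  poly_space W z /\
  forall u : {poly R}, poly_space W u ->
    (residual a b alpha beta eps f (horner z)
       <= residual a b alpha beta eps f (horner u))%E.

(* Main.v *)
Require Import Defs.
From mathcomp Require Import measurable_realfun ring lra zify.

(* Two facts give the bound. Stability: if [v] vanishes at both ends and
   [g = v - eps^2 v''], then [g^2 = v^2 + 2 eps^2 v'^2 + eps^4 v''^2
   - 2 eps^2 (v v')'], so the balanced norm of [v] is at most the L^2 norm of
   [g]; the boundary values are first removed with exact exponential layers, and
   the balanced norm of [z - U] is controlled by the residual of [z].
   Approximation: some polynomial of degree at most [W] has residual [O(1/W)].
   It is the sum of
   - a polynomial [q] interpolating, at the end points, the layer-free solution
     [u] that equals [f + eps^2 f''] there; [q''] is a Bernstein polynomial of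
     [u''], which is Lipschitz uniformly in [eps] by the maximum principle;
   - multiples of [(1 - (x - a)/M)^W] and of its mirror image, with
     [M = max (b - a, W eps)], which replace the exponential layers. *)

Set Implicit Arguments.
Unset Strict Implicit.
Unset Printing Implicit Defensive.

Local Open Scope classical_set_scope.
Local Open Scope ring_scope.

(** * Analytic functions *)

(** The target bounds a squared norm by O(1/W), so a sup-norm error O(W^(-1/2)) suffices. This is
    why a Bernstein polynomial of a Lipschitz function is accurate enough.

    It is [u''], not [u], that gets approximated. Since [u - eps^2 u'' = f], the residual of [q] is
    [eps^2 (u'' - q'') - (u - q)], and the second term is recovered by integrating twice from the
    interpolated end values. The only uniformity needed is thus that of the Lipschitz constant of
    [u'']. The end values [f + eps^2 f''] secure it: with [f] alone, the same argument would leave a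
    term of size 1/eps^2 in the bound on [u'''].

    The scale [M] of the polynomial layers separates two regimes. If [W eps] exceeds the length of
    the interval, [(1 - y/(W eps))^W] imitates [exp(-y/eps)] and its residual is pointwise O(1/W).
    Otherwise the layer is too thin to be resolved, but [(1 - y/L)^W] with [L = b - a] is itself so
    concentrated at the end point that its squared L^2 norm is O(1/W). *)

Lemma natr_mul_expr_bound (R : realType) (q : R) (n : nat) :
  0 <= q -> q <= 1 -> (1 - q) * (n.+1%:R * q ^+ n) <= 1 - q ^+ n.+1.
Proof.
(* The bound reflects 1 - q^(n+1) = (1 - q)(1 + q + ... + q^n), where every summand is at least q^n;
   the induction avoids the sum. *)
move=> q0 q1; elim: n => [|n IH]; first by rewrite expr0 expr1 !mulr1.
have qn0 : 0 <= q ^+ n.+1 by exact: exprn_ge0.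
have qn1 : q ^+ n.+1 <= 1 by exact: exprn_ile1.
have e1 : (1 - q) * (n.+2%:R * q ^+ n.+1) =
    q * ((1 - q) * (n.+1%:R * q ^+ n)) + (1 - q) * q ^+ n.+1.
  by rewrite (exprS q n) -[n.+2%:R]natr1; ring.
rewrite e1 [q ^+ n.+2]exprS; nra.
Qed.

(** Comparison at an intermediate radius [y] between [|x|] and [|K|]: with [q = |x|/y], the extra
    factor [(n+1) q^n] is at most [1/(1 - q)], so the terms are dominated by those of a series
    converging absolutely at [y]. *)
Lemma is_cvg_pseries_diffs (R : realType) (c : R^nat) (K x : R) :
  cvgn (pseries c K) -> `|x| < `|K| -> cvgn (pseries (pseries_diffs c) x).
Proof.
move=> cK xK; set y := (`|x| + `|K|) / 2.
have y0 : 0 < y by rewrite /y; have := normr_ge0 x; lra.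
have xy : `|x| < y by rewrite /y; lra.
have yK : `|y| < `|K| by rewrite (gtr0_norm y0) /y; lra.
have cy := is_cvg_pseries_inside_norm cK yK.
set q := `|x| / y.
have q0 : 0 <= q by rewrite divr_ge0 ?(ltW y0).
have q1 : q < 1 by rewrite ltr_pdivrMr// mul1r.
set C := ((1 - q) * y)^-1.
have C0 : 0 <= C by rewrite invr_ge0 mulr_ge0 ?(ltW y0)// subr_ge0 ltW.
apply: normed_cvg.
have h1 n : 0 <= `|pseries_diffs c n * x ^+ n| by [].
have h2 n : 0 <= C * (`|c n.+1| * y ^+ n.+1).
  by rewrite mulr_ge0// mulr_ge0// exprn_ge0// ltW.
apply: (@series_le_cvg _ _ (fun n => C * (`|c n.+1| * y ^+ n.+1)) h1 h2) => [n /=|].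
  rewrite normrM normrX /pseries_diffs normrM normr_nat.
  have xE : `|x| = q * y by rewrite /q mulfVK// gt_eqF.
  rewrite xE exprMn.
  rewrite [leRHS](_ : _ = `|c n.+1| * y ^+ n * (C * y)); last by rewrite exprS; ring.
  rewrite [leLHS](_ : _ = `|c n.+1| * y ^+ n * (n.+1%:R * q ^+ n)); last by ring.
  apply: ler_wpM2l; first by rewrite mulr_ge0// exprn_ge0// ltW.
  have -> : C * y = (1 - q)^-1.
    by rewrite /C invfM mulfVK// gt_eqF.
  rewrite -[leRHS]mul1r ler_pdivlMr ?subr_gt0// [leLHS]mulrC.
  by rewrite (le_trans (natr_mul_expr_bound n q0 (ltW q1)))// lerBlDr lerDl exprn_ge0.
apply: is_cvg_seriesZ.
(* The dominating series is the one at [y] without its term of index 0, hence the shift. *)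
have := cy; rewrite /pseries -(is_cvg_series_restrict 1%N) => /cvg_ex[l].
rewrite -cvg_shiftS => hl; apply/cvg_ex; exists l.
apply: cvg_trans hl; apply: near_eq_cvg; near=> n.
by rewrite /series /= big_add1.
Unshelve. all: by end_near. Qed.

Lemma analytic_at_pseries (R : realType) (f : R -> R) (c : R) :
  analytic_at f c -> exists (s : R^nat) (r : R), [/\ 0 < r,
    forall x, `|x - c| < r -> f x = limn (pseries s (x - c)) &
    forall y, `|y| < r -> cvgn (pseries s y)].
Proof.
move=> [s /nbhs_ballP[r /= r0 hr]]; exists s, r; split => // [x xr|y yr].
  by apply/esym/cvg_lim => //; apply: hr; rewrite /ball /= distrC.
have := hr (c + y); rewrite /ball /= opprD addNKr normrN => /(_ yr).
by rewrite addrAC subrr add0r => /cvgP.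
Qed.

(** Termwise differentiation asks for the series and its first two derived series to converge at one
    point farther out than [y]; the midpoint of [|y|] and [r] serves for all three. *)
Lemma pseries_is_derive (R : realType) (s : R^nat) (r y : R) :
  (forall y, `|y| < r -> cvgn (pseries s y)) -> `|y| < r ->
  is_derive y 1 (fun y => limn (pseries s y)) (limn (pseries (pseries_diffs s) y)).
Proof.
move=> hs yr.
have step (t : R^nat) : (forall y, `|y| < r -> cvgn (pseries t y)) ->
    forall y, `|y| < r -> cvgn (pseries (pseries_diffs t) y).
  move=> ht z zr; apply: (@is_cvg_pseries_diffs _ _ ((`|z| + r) / 2)).
    by apply: ht; rewrite ger0_norm; have := normr_ge0 z; lra.
  by rewrite [ltRHS]ger0_norm; have := normr_ge0 z; lra.
have hK : `|(`|y| + r) / 2| < r by rewrite ger0_norm; have := normr_ge0 y; lra.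
apply: (@pseries_snd_diffs _ _ ((`|y| + r) / 2)).
- exact: hs.
- exact: step hs _ hK.
- exact: step (step _ hs) _ hK.
- by rewrite [ltRHS]ger0_norm; have := normr_ge0 y; lra.
Qed.

Lemma analytic_at_derive (R : realType) (f : R -> R) (c : R) :
  analytic_at f c -> derivable f c 1 /\ analytic_at (derive1 f) c.
Proof.
move=> /analytic_at_pseries[s [r [r0 fE hs]]].
have D x : `|x - c| < r ->
    is_derive x 1 f (limn (pseries (pseries_diffs s) (x - c))).
  move=> xr; apply: (@near_eq_is_derive _ _ _ (fun x => limn (pseries s (x - c)))).
    apply/nbhs_ballP; exists (r - `|x - c|) => /=; first by rewrite subr_gt0.
    move=> t; rewrite /ball /= => xt; rewrite fE//.
    have := ler_distD x t c; rewrite (distrC t x); lra.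
  have := pseries_is_derive hs xr.
  move/(@is_derive1_comp _ _ (fun x => x - c) x) => /(_ 1).
  by rewrite mulr1; apply; apply: is_derive_eq; rewrite subr0.
split; first by apply: (@ex_derive _ _ _ _ _ _ _ (D c _)); rewrite subrr normr0.
exists (pseries_diffs s); apply/nbhs_ballP; exists r => //= x.
rewrite /ball /= distrC => xr.
have -> : derive1 f x = limn (pseries (pseries_diffs s) (x - c)).
  by rewrite derive1E; have Dx := D x xr; rewrite derive_val.
apply: (@is_cvg_pseries_diffs _ _ ((`|x - c| + r) / 2)).
  by apply: hs; rewrite ger0_norm; have := normr_ge0 (x - c); lra.
by rewrite [ltRHS]ger0_norm; have := normr_ge0 (x - c); lra.
Qed.

Lemma analytic_derive1n (R : realType) (D : set R) (f : R -> R) (n : nat) (x : R) :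
  analytic_on D f -> D x ->
  is_derive x 1 (derive1n n f) (derive1n n.+1 f x).
Proof.
move=> hf Dx.
suff /analytic_at_derive[/derivableP] : analytic_at (derive1n n f) x.
  by rewrite -derive1E.
elim: n => [|n IH]; first exact: hf.
by have [] := analytic_at_derive IH.
Qed.

Lemma analytic_derive1n_bounded (R : realType) (a b : R) (f : R -> R) (n : nat) :
  a <= b -> analytic_on `[a, b] f ->
  exists2 M, 0 <= M & forall x, x \in `[a, b] -> `|derive1n n f x| <= M.
Proof.
move=> ab hf.
have cf : {within `[a, b], continuous (fun x => `|derive1n n f x|)}.
  move=> x; apply: continuous_comp; last exact: norm_continuous.
  apply: (@derivable_within_continuous _ _ (derive1n n f) `[a, b]) => y yab.
  exact: (@ex_derive _ _ _ _ _ _ _ (analytic_derive1n n hf yab)).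
have [c _ hc] := EVT_max ab cf.
by exists `|derive1n n f c|.
Qed.

(** * Second-order boundary value problems *)

(** Derivatives are required strictly between [x] and [y] only, in either order, so that an end
    point where the function is merely continuous may be one of the two points. *)
Lemma derive_bound_lipschitz (R : realType) (i : interval R) (f df : R -> R)
    (B x y : R) : {within [set` i], continuous f} ->
  (forall z, (x < z < y) || (y < z < x) -> is_derive z 1 f (df z)) ->
  (forall z, (x < z < y) || (y < z < x) -> `|df z| <= B) ->
  x \in i -> y \in i ->
  `|f x - f y| <= B * `|x - y|.
Proof.
move=> cf; wlog xy : x y / x <= y.
  move=> H; have /orP[xy|yx] := le_total x y; first exact: H.
  move=> dfE dfB xi yi; rewrite distrC (distrC x).
  by apply: (H y x yx) => // z; rewrite orbC => h; [exact: dfE | exact: dfB].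
move=> dfE dfB xi yi.
have cfxy : {within `[x, y], continuous f}.
  apply: continuous_subspaceW cf => z /=; rewrite in_itv /= => /andP[xz zy].
  by apply: (@interval_is_interval _ i x y xi yi z); rewrite xz zy.
move: xy; rewrite le_eqVlt => /predU1P[xy|xy].
  by rewrite xy !subrr normr0 mulr0.
have [|z] := @MVT R f df x y xy _ cfxy.
  by move=> z; rewrite in_itv /= => h; apply: dfE; rewrite h.
rewrite in_itv /= => zxy.
rewrite distrC => ->; rewrite normrM (distrC x) ler_wpM2r//.
by apply: dfB; rewrite zxy.
Qed.

Lemma between_itvoo (R : realType) (a b x y z : R) :
  x \in `[a, b] -> y \in `[a, b] -> (x < z < y) || (y < z < x) -> z \in `]a, b[.
Proof. by rewrite !in_itv /= => hx hy /orP[] hz; lra. Qed.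

Section second_order.
Variables (R : realType) (a b : R) (w w1 w2 : R -> R).
Hypotheses (hab : a < b) (cw : {within `[a, b], continuous w}).
Hypotheses (dw : forall x, x \in `]a, b[ -> is_derive x 1 w (w1 x))
  (dw1 : forall x, x \in `]a, b[ -> is_derive x 1 w1 (w2 x)).

(** Rolle gives a zero of [w1]; the mean value inequality from that zero bounds [w1], and from [a]
    it then bounds [w]. *)
Lemma second_derivative_bound (B : R) : w a = 0 -> w b = 0 ->
  (forall x, x \in `]a, b[ -> `|w2 x| <= B) ->
  (forall x, x \in `]a, b[ -> `|w1 x| <= B * (b - a)) /\
  (forall x, x \in `[a, b] -> `|w x| <= B * (b - a) ^+ 2).
Proof.
move=> wa wb hB.
have ooc x : x \in `]a, b[ -> x \in `[a, b].
  by rewrite !in_itv /= => /andP[/ltW -> /ltW ->].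
have B0 : 0 <= B.
  have mab : (a + b) / 2 \in `]a, b[ by exact: mid_in_itvoo.
  exact: le_trans (hB _ mab).
have [c cab dc0] : exists2 c, c \in `]a, b[ & is_derive c 1 w 0.
  by apply: Rolle => //; [move=> x /dw [] | rewrite wa wb].
have w1c : w1 c = 0.
  by have [_ <-] := dw cab; have [_ ->] := dc0.
have cw1 : {within `]a, b[, continuous w1}.
  by apply: derivable_within_continuous => x /dw1 [].
have h1 x : x \in `]a, b[ -> `|w1 x| <= B * (b - a).
  move=> xab; have H := @derive_bound_lipschitz R _ w1 w2 B x c cw1.
  rewrite w1c (subr0 (w1 x)) in H; apply: le_trans (H _ _ xab cab) _ => [z hz|z hz|].
  - by apply/dw1/(between_itvoo (ooc _ xab) (ooc _ cab) hz).
  - by apply/hB/(between_itvoo (ooc _ xab) (ooc _ cab) hz).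
  by rewrite ler_wpM2l// ler_norml; move: xab cab; rewrite !in_itv /=; lra.
split=> // x xab.
have aab : a \in `[a, b] by rewrite in_itv /= lexx ltW.
have H := @derive_bound_lipschitz R _ w w1 (B * (b - a)) x a cw.
rewrite wa (subr0 (w x)) in H; apply: le_trans (H _ _ xab aab) _ => [z hz|z hz|].
- by apply/dw/(between_itvoo xab aab hz).
- by apply/h1/(between_itvoo xab aab hz).
rewrite expr2 mulrA ler_wpM2l ?mulr_ge0 ?subr_ge0 ?(ltW hab)//.
by rewrite ler_norml; move: xab; rewrite in_itv /=; lra.
Qed.

(** At an interior maximum [c] with [w c > M], [w1 c = 0] and [k * w2 c >= w c - M > 0]. Then [w1]
    is positive just to the right of [c], so [w] still increases there: a contradiction. *)
Lemma max_principle_le (k M : R) : 0 < k -> 0 <= M -> w a = 0 -> w b = 0 ->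
  (forall x, x \in `]a, b[ -> w x - k * w2 x <= M) ->
  forall x, x \in `[a, b] -> w x <= M.
Proof.
move=> k0 M0 wa wb hM x xab.
have [c cab hc] := EVT_max (ltW hab) cw.
apply: le_trans (hc _ xab) _; rewrite leNgt; apply/negP => Mc.
have cab' : c \in `]a, b[.
  move: cab; rewrite !in_itv /= !le_eqVlt => /andP[/predU1P[ac|->] /predU1P[cb|->]] //;
    exfalso; move: Mc; first by rewrite -ac wa ltNge M0.
    by rewrite -ac wa ltNge M0.
  by rewrite cb wb ltNge M0.
have w1c : w1 c = 0.
  have dc0 : is_derive c 1 w 0.
    apply: (derive1_at_max (ltW hab) _ cab') => t; first by move/dw => [].
    by move=> tab; apply: hc; move: tab; rewrite !in_itv /= => /andP[/ltW -> /ltW ->].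
  by have [_ <-] := dw cab'; have [_ ->] := dc0.
have w2c : 0 < w2 c.
  have := hM _ cab'; rewrite lerBlDr => h.
  have : 0 < k * w2 c by lra.
  by rewrite pmulr_rgt0.
(* [w2] is not known to be continuous, so the sign of [w1] near [c] is read from its difference
   quotients at [c]. *)
have [dw1c e1] := dw1 cab'.
move: dw1c => /cvg_ex[l hl]; have l0 : 0 < l.
  suff -> : l = w2 c by [].
  by rewrite -e1; apply/esym/cvg_lim.
move/cvgr_gt : hl => /(_ _ l0)/nbhs_ballP[r /= r0 hr].
move: (cab'); rewrite in_itv /= => /andP[ac cb].
set d := Num.min (c + r / 2) ((c + b) / 2).
have cd : c < d by rewrite /d lt_min; lra.
have dr : d < c + r by rewrite /d gt_min; apply/orP; left; lra.
have db : d < b by rewrite /d gt_min; apply/orP; right; lra.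
have dcd z : z \in `]c, d[ -> is_derive z 1 w (w1 z).
  by rewrite in_itv /= => h; apply: dw; rewrite in_itv /=; lra.
have cwcd : {within `[c, d], continuous w}.
  by apply: continuous_subspaceW cw => z /=; rewrite !in_itv /=; lra.
have [e ecd he] := MVT cd dcd cwcd.
have we : 0 < w1 e.
  move: ecd; rewrite in_itv /= => ecd.
  have := hr (e - c); rewrite /ball /= sub0r normrN ger0_norm; last by lra.
  have er : e - c < r by lra.
  have ec : e - c != 0 by lra.
  move=> /(_ er ec); rewrite [_ *: 1]mulr1 subrK w1c subr0.
  by rewrite /GRing.scale /= pmulr_rgt0 ?invr_gt0; lra.
have dab : d \in `[a, b] by rewrite in_itv /=; lra.
have := hc d dab; rewrite leNgt => /negP; apply.
by rewrite -subr_gt0 he mulr_gt0// subr_gt0.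
Qed.

End second_order.

Lemma max_principle (R : realType) (a b : R) (w w1 w2 : R -> R) (k M : R) :
  a < b -> {within `[a, b], continuous w} ->
  (forall x, x \in `]a, b[ -> is_derive x 1 w (w1 x)) ->
  (forall x, x \in `]a, b[ -> is_derive x 1 w1 (w2 x)) ->
  0 < k -> w a = 0 -> w b = 0 ->
  (forall x, x \in `]a, b[ -> `|w x - k * w2 x| <= M) ->
  forall x, x \in `[a, b] -> `|w x| <= M.
Proof.
move=> hab cw dw dw1 k0 wa wb hM x xab.
have M0 : 0 <= M.
  have mab : (a + b) / 2 \in `]a, b[ by exact: mid_in_itvoo.
  exact: le_trans (hM _ mab).
rewrite ler_norml; apply/andP; split; last first.
  apply: (max_principle_le hab cw dw dw1 k0) => // y yab.
  exact: le_trans (ler_norm _) (hM _ yab).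
rewrite lerNl; apply: (@max_principle_le _ a b (- w) (- w1) (- w2) hab _ _ _ k) => //.
- by move=> y; apply: continuousN; exact: cw.
- by move=> y yab; have h := dw _ yab; exact: is_deriveN.
- by move=> y yab; have h := dw1 _ yab; exact: is_deriveN.
- by rewrite [LHS]/= /GRing.opp /= wa oppr0.
- by rewrite [LHS]/= /GRing.opp /= wb oppr0.
- move=> y yab; apply: le_trans (hM _ yab).
  by rewrite -normrN; apply: le_trans (ler_norm _); rewrite !fctE; lra.
Qed.

(** * Energy estimate *)

Lemma L2norm_sq (R : realType) (a b : R) (u : R -> R) :
  (L2norm a b u ^+ 2 =
   \int[lebesgue_measure]_(x in `]a, b[) ((u x ^+ 2)%R)%:E)%E.
Proof.
rewrite /L2norm unlock /= poweR12_sqrt; last first.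
  by apply: integral_ge0 => x _; exact: poweR_ge0.
rewrite -expe2 sqr_sqrte; last by apply: integral_ge0 => x _; exact: poweR_ge0.
rewrite [RHS]integral_mkcond; apply: eq_integral => x _.
rewrite !patchE /=; case: ifPn => _ /=.
  by rewrite powR_mulrn// -normrX ger0_norm// sqr_ge0.
by rewrite normr0 powR0.
Qed.

Lemma measurable_sqr_continuous (R : realType) (a b : R) (u : R -> R) :
  {in `]a, b[, continuous u} ->
  measurable_fun `]a, b[ (EFin \o (fun x => u x ^+ 2)).
Proof.
move=> cu; apply/measurable_EFinP; apply: measurable_funX.
apply: open_continuous_measurable_fun; first exact: interval_open.
by move=> x; rewrite inE => xab; exact: cu.
Qed.

Lemma is_derive_continuous (R : realType) (f : R -> R) (x df : R) :
  is_derive x 1 f df -> {for x, continuous f}.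
Proof. by case=> df' _; apply: differentiable_continuous; exact/derivable1_diffP. Qed.

Lemma continuous_sqr (R : realType) (u : R -> R) (x : R) :
  {for x, continuous u} -> {for x, continuous (fun y => u y ^+ 2)}.
Proof. by move=> cu; exact: (continuousM cu cu). Qed.

Lemma FTC2_is_derive (R : realType) (c d : R) (F f : R -> R) : c < d ->
  (forall x, x \in `[c, d] -> is_derive x 1 F (f x)) ->
  (forall x, x \in `[c, d] -> {for x, continuous f}) ->
  (\int[lebesgue_measure]_(x in `[c, d]) (f x)%:E = (F d - F c)%:E)%E.
Proof.
move=> cd dF cf; rewrite EFinB.
have ooc x : x \in `]c, d[ -> x \in `[c, d].
  by rewrite !in_itv /= => /andP[/ltW -> /ltW ->].
apply: continuous_FTC2 => //.
- by apply: continuous_in_subspaceT => x; rewrite inE => xcd; exact: cf.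
- split.
  + by move=> x /ooc /dF [].
  + apply: cvg_at_right_filter; apply: (is_derive_continuous (dF c _)).
    by rewrite in_itv /= lexx ltW.
  + apply: cvg_at_left_filter; apply: (is_derive_continuous (dF d _)).
    by rewrite in_itv /= lexx ltW.
- by move=> x /ooc /dF h; rewrite derive1E derive_val.
Qed.

(** For [g = v - k v''] this is [v^2 + 2 k v'^2 + k^2 v''^2]; writing [k v''] as [v - g] keeps
    second derivatives out of the formula. *)
Definition energy_density (R : realType) (k : R) (v v1 g : R -> R) (x : R) :=
  v x ^+ 2 + 2 * k * v1 x ^+ 2 + (v x - g x) ^+ 2.

Section energy.
Variables (R : realType) (a b k : R) (v v1 g : R -> R).
Hypotheses (hab : a < b) (k0 : 0 < k).
Hypotheses (cv : {within `[a, b], continuous v})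
  (cg : {within `[a, b], continuous g}).
Hypotheses (dv : forall x, x \in `]a, b[ -> is_derive x 1 v (v1 x))
  (dv1 : forall x, x \in `]a, b[ -> is_derive x 1 v1 ((v x - g x) / k)).

Local Notation E := (energy_density k v v1 g).

Let cvoo x : x \in `]a, b[ -> {for x, continuous v}.
Proof. exact: within_continuous_continuous. Qed.

Let cgoo x : x \in `]a, b[ -> {for x, continuous g}.
Proof. exact: within_continuous_continuous. Qed.

Let cv1oo x : x \in `]a, b[ -> {for x, continuous v1}.
Proof. by move/dv1; exact: is_derive_continuous. Qed.

Lemma continuous_energy_density x : x \in `]a, b[ -> {for x, continuous E}.
Proof.
move=> xab; apply: continuousD; first apply: continuousD.
- exact: continuous_sqr (cvoo xab).
- apply: continuousM; first exact: cst_continuous.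
  exact: continuous_sqr (cv1oo xab).
- exact: continuous_sqr (continuousB (cvoo xab) (cgoo xab)).
Qed.

Lemma energy_identity (c d : R) : a < c -> c < d -> d < b ->
  (\int[lebesgue_measure]_(x in `[c, d]) (E x)%:E =
   \int[lebesgue_measure]_(x in `[c, d]) ((g x ^+ 2)%R)%:E +
   (2 * k * (v d * v1 d - v c * v1 c))%:E)%E.
Proof.
move=> ac cd db.
have sub x : x \in `[c, d] -> x \in `]a, b[ by rewrite !in_itv /=; lra.
(* [phi] is the derivative of [2 k v v1], and the energy density is [g^2 + phi]. *)
pose phi x := 2 * k * (v1 x ^+ 2 + v x * ((v x - g x) / k)).
have cphi x : x \in `]a, b[ -> {for x, continuous phi}.
  move=> xab; rewrite /phi; apply: continuousM; first exact: cst_continuous.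
  apply: continuousD.
    exact: continuous_sqr (cv1oo xab).
  apply: continuousM; first exact: cvoo.
  apply: continuousM; last exact: cst_continuous.
  by apply: continuousB; [exact: cvoo | exact: cgoo].
have <- : (\int[lebesgue_measure]_(x in `[c, d]) (phi x)%:E =
   (2 * k * (v d * v1 d - v c * v1 c))%:E)%E.
  have dF x : x \in `[c, d] ->
      is_derive x 1 (fun x => 2 * k * (v x * v1 x)) (phi x).
    move=> /sub xab; have h := dv xab; have h1 := dv1 xab.
    have h2 := is_deriveM h h1.
    have h3 := is_deriveZ (2 * k) h2.
    have := is_derive_eq h3; apply.
    by rewrite /phi /GRing.scale /=; ring.
  have cF x : x \in `[c, d] -> {for x, continuous phi} by move=> /sub; exact: cphi.
  have H := FTC2_is_derive cd dF cF.
  rewrite mulrBr -H.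
  by [].
rewrite -integralD_EFin //=.
- apply: eq_integral => x; rewrite inE => /sub xab.
  rewrite -EFinD; congr EFin; rewrite /energy_density /phi; field.
  exact: lt0r_neq0.
- apply: continuous_compact_integrable; first exact: segment_compact.
  apply: continuous_in_subspaceT => x; rewrite inE => /sub xab.
  exact: continuous_sqr (cgoo xab).
- apply: continuous_compact_integrable; first exact: segment_compact.
  by apply: continuous_in_subspaceT => x; rewrite inE => /sub xab; exact: cphi.
Qed.

(** [v1] has no known values at the end points, so the identity is used on inner intervals
    exhausting []a, b[]. The boundary terms [v * v1] tend to 0 there, because [v1] is bounded and
    [v] is at most a multiple of the distance to the end point. *)
Lemma energy_bound : v a = 0 -> v b = 0 ->
  (\int[lebesgue_measure]_(x in `]a, b[) (E x)%:E <=
   \int[lebesgue_measure]_(x in `]a, b[) ((g x ^+ 2)%R)%:E)%E.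
Proof.
move=> va vb.
have E0 x : 0 <= E x.
  rewrite /energy_density addr_ge0 ?sqr_ge0// addr_ge0 ?sqr_ge0//.
  by rewrite mulr_ge0 ?sqr_ge0// mulr_ge0// ltW.
have [B [B0 hv1 hv]] : exists B, [/\ 0 <= B,
    forall x, x \in `]a, b[ -> `|v1 x| <= B &
    forall x, x \in `]a, b[ ->
      `|v x| <= B * (x - a) /\ `|v x| <= B * (b - x)].
  have cvg' : {within `[a, b], continuous (fun x => `|v x - g x|)}.
    by move=> x; apply: cvg_norm; exact: (within_continuousB cv cg).
  have [m mab hm] := EVT_max (ltW hab) cvg'.
  have ooc x : x \in `]a, b[ -> x \in `[a, b].
    by rewrite !in_itv /= => /andP[/ltW -> /ltW ->].
  have [|hv1 _] := @second_derivative_bound R a b v v1 _ hab cv dv dv1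
    (`|v m - g m| / k) va vb.
    move=> x /ooc xab; rewrite normrM normfV (gtr0_norm k0).
    by rewrite ler_wpM2r ?invr_ge0 ?(ltW k0)//; exact: hm.
  set B := _ * _ in hv1; exists B; split => //.
    by rewrite /B mulr_ge0 ?subr_ge0 ?(ltW hab)// divr_ge0// ltW.
  move=> x xab; have xab' := ooc _ xab; split.
    have aab : a \in `[a, b] by rewrite in_itv /= lexx ltW.
    have H := @derive_bound_lipschitz R _ v v1 B x a cv.
    rewrite va (subr0 (v x)) in H; move: (xab); rewrite in_itv /= => hx.
    apply: le_trans (H _ _ xab' aab) _ => [z hz|z hz|].
    + apply: dv; rewrite in_itv /=; case/orP: hz => hz; lra.
    + apply: hv1; rewrite in_itv /=; case/orP: hz => hz; lra.
    + by rewrite gtr0_norm; lra.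
  have bab : b \in `[a, b] by rewrite in_itv /= lexx ltW.
  have H := @derive_bound_lipschitz R _ v v1 B x b cv.
  rewrite vb (subr0 (v x)) in H; move: (xab); rewrite in_itv /= => hx.
  apply: le_trans (H _ _ xab' bab) _ => [z hz|z hz|].
  + apply: dv; rewrite in_itv /=; case/orP: hz => hz; lra.
  + apply: hv1; rewrite in_itv /=; case/orP: hz => hz; lra.
  + by rewrite ltr0_norm; lra.
(* The factor 1/3 keeps every inner interval nonempty, including the one for [n = 0]. *)
pose dl n : R := (b - a) / 3 * n.+1%:R^-1.
have dl0 n : 0 < dl n by rewrite /dl mulr_gt0 ?invr_gt0// divr_gt0 ?subr_gt0.
have dl3 n : dl n <= (b - a) / 3.
  have L3 : 0 <= (b - a) / 3 by rewrite divr_ge0// subr_ge0 ltW.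
  have i1 : n.+1%:R^-1 <= 1 :> R by rewrite invf_le1 ?ltr0n// ler1n.
  by rewrite /dl ler_piMr.
pose F n := `[a + dl n, b - dl n]%classic.
have mE : measurable_fun `]a, b[ (EFin \o E).
  apply/measurable_EFinP; apply: open_continuous_measurable_fun.
    exact: interval_open.
  by move=> x; rewrite inE; exact: continuous_energy_density.
have mg := measurable_sqr_continuous cgoo.
have subF n : F n `<=` `]a, b[.
  by move=> x; rewrite /F /= !in_itv /=; have := dl0 n; lra.
have FU : \bigcup_n F n = `]a, b[%classic.
  apply/seteqP; split => [x [n _]|x]; first exact: subF.
  rewrite /= in_itv /= => /andP[ax xb].
  have r0 : 0 < Num.min (x - a) (b - x) / (b - a).
    by apply: divr_gt0; rewrite ?lt_min !subr_gt0 ?ax.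
  have [n _ hn] := near_infty_natSinv_lt (PosNum r0).
  have {}hn := hn n (leqnn n); exists n => //.
  move: hn; rewrite /= ltr_pdivlMr ?subr_gt0// lt_min => /andP[h1 h2].
  have i0 : 0 < n.+1%:R^-1 :> R by rewrite invr_gt0.
  have p0 : 0 < n.+1%:R^-1 * (b - a) by rewrite mulr_gt0// subr_gt0.
  rewrite /F /= in_itv /= /dl; move: (n.+1%:R^-1) p0 h1 h2 => q p0 h1 h2.
  have -> : (b - a) / 3 * q = q * (b - a) / 3 by ring.
  move: (q * (b - a)) p0 h1 h2 => p; lra.
have ndF : nondecreasing_seq F.
  move=> m n mn; apply/subsetPset => x; rewrite /F /= !in_itv /=.
  have : dl n <= dl m.
    have L3 : 0 <= (b - a) / 3 by rewrite divr_ge0// subr_ge0 ltW.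
    by rewrite /dl ler_wpM2l// lef_pV2 ?posrE ?ltr0n// ler_nat.
  lra.
have cvgE : (fun i => \int[lebesgue_measure]_(x in F i) (E x)%:E)%E @ \oo -->
    (\int[lebesgue_measure]_(x in `]a, b[) (E x)%:E)%E.
  rewrite -FU; apply: ge0_nondecreasing_set_cvg_integral => //.
  - by move=> i; exact: measurable_itv.
  - by move=> i; apply: measurable_funS mE => //; exact: subF.
  - by move=> i x _; rewrite lee_fin.
rewrite -(cvg_lim _ cvgE)//; apply/lee_addgt0Pr => e e0.
apply: lime_le; first exact: (cvgP _ cvgE).
have ab := hab.
(* The boundary terms are at most [4 k B^2 dl n]; adding 1 makes the divisor positive even when
   [B = 0]. *)
have M0 : 0 < 4 * k * (B * B * (b - a)) + 1.
  have : 0 <= k * (B * B * (b - a)).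
    by rewrite mulr_ge0 ?(ltW k0)// !mulr_ge0// subr_ge0 ltW.
  lra.
have := near_infty_natSinv_lt (PosNum (divr_gt0 e0 M0)).
apply: filterS => n /= hn.
have Ln := dl0 n; have Ln3 := dl3 n.
have cd : a + dl n < b - dl n by lra.
rewrite energy_identity; [|lra..].
apply: leeD.
  apply: ge0_subset_integral => //; last exact: subF.
  by move=> x _; rewrite lee_fin sqr_ge0.
rewrite lee_fin.
have cab : a + dl n \in `]a, b[ by rewrite in_itv /=; lra.
have dab : b - dl n \in `]a, b[ by rewrite in_itv /=; lra.
have [hc _] := hv _ cab; have [_ hd] := hv _ dab.
have h1c := hv1 _ cab; have h1d := hv1 _ dab.
have bd : v (b - dl n) * v1 (b - dl n) - v (a + dl n) * v1 (a + dl n) <=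
    2 * (B * B * dl n).
  apply: le_trans (ler_norm _) _; apply: le_trans (ler_normB _ _) _.
  rewrite !normrM.
  have -> : 2 * (B * B * dl n) = B * dl n * B + B * dl n * B by ring.
  apply: lerD; apply: ler_pM => //.
    by apply: le_trans hd _; rewrite opprB addrCA subrr addr0.
  by apply: le_trans hc _; rewrite addrAC subrr add0r.
apply: (@le_trans _ _ (2 * k * (2 * (B * B * dl n)))).
  by rewrite ler_wpM2l// mulr_ge0// ltW.
move: hn; rewrite ltr_pdivlMr// => hn.
apply: le_trans (ltW hn); rewrite /dl.
have i0 : 0 < n.+1%:R^-1 :> R by rewrite invr_gt0.
set q := n.+1%:R^-1 in i0 *.
have K0 : 0 <= k * (B * B * (b - a)).
  by rewrite mulr_ge0 ?(ltW k0)// !mulr_ge0// subr_ge0 ltW.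
rewrite [leLHS](_ : _ = q * (4 / 3 * (k * (B * B * (b - a))))); last by field.
by rewrite ler_pM2l//; lra.
Qed.

End energy.

(** * Exponential and polynomial layers *)

(** Amplitudes of two mirror-image layers, each equal to 1 at its own end and to [r] at the other.
    The hypothesis gives 1 - r^2 >= 1 - r >= L/(1 + L), so the inverse determinant is bounded by a
    constant free of [eps]. *)
Lemma layer_coefficients (R : realFieldType) (L r A B : R) :
  0 < L -> 0 <= r -> r * (1 + L) <= 1 ->
  exists A' B' : R, [/\ A' + r * B' = A, r * A' + B' = B,
    `|A'| <= (1 + L^-1) * (`|A| + `|B|) & `|B'| <= (1 + L^-1) * (`|A| + `|B|)].
Proof.
move=> L0 r0 rL.
have r1 : r < 1 by nra.
have d0 : 0 < 1 - r ^+ 2 by rewrite expr2; nra.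
have dK : (1 - r ^+ 2)^-1 <= 1 + L^-1.
  have -> : 1 + L^-1 = (L / (1 + L))^-1 by field; apply/andP; split; lra.
  rewrite lef_pV2 ?posrE//; last by rewrite divr_gt0//; lra.
  by rewrite ler_pdivrMr ?expr2; nra.
have bnd (x y : R) : `|(x - r * y) / (1 - r ^+ 2)| <= (1 + L^-1) * (`|x| + `|y|).
  rewrite normrM [leLHS]mulrC normfV (gtr0_norm d0) ler_pM//.
    by rewrite invr_ge0 ltW.
  apply: le_trans (ler_normB _ _) _; rewrite lerD2l normrM (ger0_norm r0).
  by rewrite ler_piMl// ltW.
exists ((A - r * B) / (1 - r ^+ 2)), ((B - r * A) / (1 - r ^+ 2)); split.
- by field; rewrite lt0r_neq0.
- by field; rewrite lt0r_neq0.
- exact: bnd.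
- by rewrite [`|A| + _]addrC; exact: bnd.
Qed.

Lemma exp_layer (R : realType) (a b eps A B : R) :
  a < b -> 0 < eps -> eps <= 1 ->
  exists y y1 : R -> R, [/\ forall x : R, is_derive x 1 y (y1 x),
    forall x : R, is_derive x 1 y1 (y x / eps ^+ 2), y a = A, y b = B &
    forall x, x \in `[a, b] ->
      `|y x| <= 2 * (1 + (b - a)^-1) * (`|A| + `|B|) /\
      `|eps * y1 x| <= 2 * (1 + (b - a)^-1) * (`|A| + `|B|)].
Proof.
move=> ab e0 e1; have L0 : 0 < b - a by rewrite subr_gt0.
have en0 : eps != 0 by rewrite lt0r_neq0.
set r := expR ((a - b) / eps).
have r0 : 0 <= r by exact: expR_ge0.
(* Since [eps <= 1], 1 + L <= 1 + L/eps <= exp(L/eps), which is the inverse of [r]. *)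
have rL : r * (1 + (b - a)) <= 1.
  apply: (@le_trans _ _ (r * (1 + (b - a) / eps))).
    rewrite ler_wpM2l// lerD2l ler_pdivlMr// ler_piMr//; exact: ltW.
  apply: (@le_trans _ _ (r * expR ((b - a) / eps))).
    by rewrite ler_wpM2l// expR_ge1Dx.
  rewrite /r -expRD -mulrDl (_ : a - b + (b - a) = 0); last by ring.
  by rewrite mul0r expR0.
have [A' [B' [hA hB bA bB]]] := layer_coefficients A B L0 r0 rL.
pose E1 x := expR ((a - x) / eps); pose E2 x := expR ((x - b) / eps).
have dE1 (x : R) : is_derive x 1 E1 (- E1 x / eps).
  have h : is_derive x 1 (fun x => (a - x) / eps) (- eps^-1).
    by apply: is_derive_eq; rewrite /GRing.scale /=; ring.
  have := @is_derive1_comp _ expR (fun x => (a - x) / eps) x _ _ (is_derive_expR _) h.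
  by move=> h2; apply: is_derive_eq; rewrite mulrN -mulNr.
have dE2 (x : R) : is_derive x 1 E2 (E2 x / eps).
  have h : is_derive x 1 (fun x => (x - b) / eps) (eps^-1).
    by apply: is_derive_eq; rewrite /GRing.scale /=; ring.
  exact: (@is_derive1_comp _ expR (fun x => (x - b) / eps) x _ _ (is_derive_expR _) h).
exists (fun x => A' * E1 x + B' * E2 x).
exists (fun x => (- (A' * E1 x) + B' * E2 x) / eps); split.
- move=> x; have h1 := dE1 x; have h2 := dE2 x.
  by apply: is_derive_eq; rewrite /GRing.scale /=; ring.
- move=> x; have h1 := dE1 x; have h2 := dE2 x.
  by apply: is_derive_eq; rewrite /GRing.scale /=; field.
- by rewrite /E1 /E2 subrr mul0r expR0 mulr1 [B' * _]mulrC.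
- by rewrite /E1 /E2 subrr mul0r expR0 mulr1 [A' * _]mulrC.
move=> x; rewrite in_itv /= => /andP[ax xb].
have e11 : `|E1 x| <= 1.
  rewrite ger0_norm ?expR_ge0// -[leRHS]expR0 ler_expR.
  by rewrite pmulr_lle0 ?invr_gt0// subr_le0.
have e21 : `|E2 x| <= 1.
  rewrite ger0_norm ?expR_ge0// -[leRHS]expR0 ler_expR.
  by rewrite pmulr_lle0 ?invr_gt0// subr_le0.
have h1 : `|A' * E1 x| <= (1 + (b - a)^-1) * (`|A| + `|B|).
  by rewrite normrM; apply: le_trans (ler_piMr _ e11) bA.
have h2 : `|B' * E2 x| <= (1 + (b - a)^-1) * (`|A| + `|B|).
  by rewrite normrM; apply: le_trans (ler_piMr _ e21) bB.
have -> : 2 * (1 + (b - a)^-1) * (`|A| + `|B|) =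
    (1 + (b - a)^-1) * (`|A| + `|B|) + (1 + (b - a)^-1) * (`|A| + `|B|) by ring.
split; first exact: le_trans (ler_normD _ _) (lerD h1 h2).
rewrite mulrC mulfVK//; apply: le_trans (ler_normD _ _) _.
by rewrite normrN lerD.
Qed.

(* In the case [m.+2 * eps <= L] the residual is not small, but the second term
   has L^2 norm squared [O(1/m)]; otherwise the first term suffices. *)
Lemma polynomial_layer_residual (R : realType) (m : nat) (eps L y : R) :
  0 < eps -> 0 < L -> 0 <= y -> y <= L ->
  let M := Num.max L (m.+2%:R * eps) in
  `|(1 - y / M) ^+ m.+2
    - eps ^+ 2 * (m.+2%:R * m.+1%:R / M ^+ 2) * (1 - y / M) ^+ m| <=
  5 / m.+2%:R + (1 - y / L) ^+ m.
Proof.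
move=> e0 L0 y0 yL; cbv zeta; set M := Num.max _ _.
have n0 : 0 < m.+2%:R :> R by [].
have n1 : m.+1%:R = m.+2%:R - 1 :> R by rewrite -[m.+2%:R]natr1 addrK.
have n2 : 2 <= m.+2%:R :> R by rewrite ler_nat.
have M0 : 0 < M by rewrite lt_max L0.
set u := y / M.
have u0 : 0 <= u by rewrite divr_ge0// ltW.
have u1 : u <= 1 by rewrite ler_pdivrMr// mul1r le_max yL.
have q0 : 0 <= (1 - u) ^+ m by rewrite exprn_ge0// subr_ge0.
have -> : (1 - u) ^+ m.+2
    - eps ^+ 2 * (m.+2%:R * m.+1%:R / M ^+ 2) * (1 - u) ^+ m =
    (1 - u) ^+ m * ((1 - u) ^+ 2 -
      (m.+2%:R * eps / M) ^+ 2 * (1 - m.+2%:R^-1)).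
  rewrite n1 !exprS expr0; field; apply/andP; split; exact: lt0r_neq0.
rewrite normrM (ger0_norm q0).
have i0 : 0 < m.+2%:R^-1 :> R by rewrite invr_gt0.
have i1 : m.+2%:R^-1 <= 2^-1 :> R by rewrite lef_pV2// posrE.
have [nL|Ln] := leP (m.+2%:R * eps) L.
  have ML : M = L by rewrite /M max_l.
  (* Unresolved layer: the bracket is a difference of two numbers in [0, 1], so only the power [m]
     of [1 - u] is kept. *)
  apply: (@le_trans _ _ ((1 - u) ^+ m)); last first.
    by rewrite /u ML lerDr divr_ge0.
  rewrite ler_piMr//.
  have k0 : 0 <= m.+2%:R * eps / M by rewrite divr_ge0 ?mulr_ge0 ?ltW.
  have k1 : m.+2%:R * eps / M <= 1 by rewrite ML ler_pdivrMr// mul1r.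
  set k := _ / M in k0 k1 *.
  have kk0 : 0 <= k ^+ 2 by exact: sqr_ge0.
  have kk1 : k ^+ 2 <= 1 by exact: exprn_ile1.
  have uu0 : 0 <= (1 - u) ^+ 2 by exact: sqr_ge0.
  have uu1 : (1 - u) ^+ 2 <= 1 by rewrite exprn_ile1//; lra.
  move: (m.+2%:R^-1) i0 i1 => i i0 i1.
  have ki0 : 0 <= k ^+ 2 * (1 - i) by rewrite mulr_ge0//; lra.
  have ki1 : k ^+ 2 * (1 - i) <= 1 by rewrite mulr_ile1//; lra.
  by rewrite ler_norml; apply/andP; split; lra.
(* Resolved layer: the leading coefficients cancel and the bracket is at most 1/n + 2u, with n = m +
   2. As [u (1-u)^m] is at most 1/(n - 1) <= 2/n, the total is 5/n. *)
have ML : M = m.+2%:R * eps by rewrite /M max_r// ltW.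
have -> : m.+2%:R * eps / M = 1 by rewrite -ML divff// lt0r_neq0.
rewrite expr1n mul1r.
apply: (@le_trans _ _ (5 / m.+2%:R)); last first.
  by rewrite lerDl exprn_ge0// subr_ge0 ler_pdivrMr// mul1r.
have hb : u * (m.+1%:R * (1 - u) ^+ m) <= 1.
  have h1u : 0 <= 1 - u by lra.
  have h2u : 1 - u <= 1 by lra.
  have := natr_mul_expr_bound m h1u h2u.
  rewrite subKr => /le_trans; apply.
  by rewrite lerBlDr lerDl exprn_ge0.
have q1 : (1 - u) ^+ m <= 1 by rewrite exprn_ile1//; lra.
apply: (@le_trans _ _ ((1 - u) ^+ m * (m.+2%:R^-1 + 2 * u))).
  rewrite ler_wpM2l// ler_norml expr2.
  by move: (m.+2%:R^-1) i0 i1 => i i0 i1; apply/andP; split; nra.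
rewrite n1 in hb.
set q := (1 - u) ^+ m in q0 q1 hb *; set n := m.+2%:R in n0 n1 n2 hb i0 i1 *.
have uq : u * q <= 2 / n.
  rewrite ler_pdivlMr//; have : 0 <= u * q by rewrite mulr_ge0.
  nra.
have -> : q * (n^-1 + 2 * u) = q * n^-1 + 2 * (u * q) by ring.
have : q * n^-1 <= n^-1 by rewrite ler_piMl// ltW.
by move: (n^-1) uq => j uq; lra.
Qed.

Lemma bernoulli_ineq (R : realFieldType) (u : R) (n : nat) :
  0 <= u -> 1 + n%:R * u <= (1 + u) ^+ n.
Proof.
move=> u0; elim: n => [|n IH]; first by rewrite mul0r addr0 expr0.
rewrite exprS; apply: (@le_trans _ _ ((1 + u) * (1 + n%:R * u))).
  rewrite -natr1; have : 0 <= n%:R * u * u by rewrite !mulr_ge0.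
  lra.
by rewrite ler_wpM2l//; lra.
Qed.

Lemma size_linear_exp (R : realType) (c0 c1 : R) (n : nat) :
  (size ((c0%:P + c1 *: 'X) ^+ n)%R <= n.+1)%N.
Proof.
apply: leq_trans (size_poly_exp_leq _ _) _; rewrite ltnS.
have : (size (c0%:P + c1 *: 'X)%R <= 2)%N.
  apply: leq_trans (size_polyD _ _) _; rewrite geq_max.
  rewrite (leq_trans (size_polyC_leq1 _))//=.
  by rewrite (leq_trans (size_scale_leq _ _))// size_polyX.
by case: (size _) => [|[|[|k]]] //= _; rewrite ?mul0n ?mul1n.
Qed.

Lemma deriv_linear_exp (R : realType) (c0 c1 : R) (n : nat) :
  ((c0%:P + c1 *: 'X) ^+ n.+1)^`() = (n.+1%:R * c1) *: (c0%:P + c1 *: 'X) ^+ n.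
Proof.
rewrite deriv_exp derivD derivC add0r derivZ derivX alg_polyC mul_polyC /=.
by rewrite -scaler_nat scalerA.
Qed.

Lemma polynomial_layer (R : realType) (a b eps A B : R) (m : nat) :
  a < b -> 0 < eps -> eps <= 1 ->
  exists P : {poly R}, [/\ (size P <= m.+3)%N, P.[a] = A, P.[b] = B &
    forall x, x \in `[a, b] ->
      `|P.[x] - eps ^+ 2 * P^`()^`().[x]| <=
      (1 + (b - a)^-1) * (`|A| + `|B|) *
      (10 / m.+2%:R + ((b - x) / (b - a)) ^+ m + ((x - a) / (b - a)) ^+ m)].
Proof.
move=> ab e0 e1; have L0 : 0 < b - a by rewrite subr_gt0.
set L := b - a in L0 *.
pose M := Num.max L (m.+2%:R * eps).
have M0 : 0 < M by rewrite lt_max L0.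
have Mn0 : M != 0 by rewrite lt0r_neq0.
set r := (1 - L / M) ^+ m.+2.
have LM0 : 0 <= 1 - L / M by rewrite subr_ge0 ler_pdivrMr// mul1r le_max lexx.
have r0 : 0 <= r by rewrite exprn_ge0.
(* If [M = L] then [r = 0]. Otherwise, with u = L/M, Bernoulli gives (1 + u)^n >= 1 + nu = 1 + L/eps
   >= 1 + L, while (1 - u)^n (1 + u)^n <= 1. *)
have rL : r * (1 + L) <= 1.
  rewrite /r /M; have [nL|Ln] := leP (m.+2%:R * eps) L.
    by rewrite divff ?lt0r_neq0// subrr expr0n mul0r.
  have n0 : 0 < m.+2%:R * eps by rewrite mulr_gt0.
  set u := L / _.
  have u0 : 0 <= u by rewrite divr_ge0 ?ltW.
  have u1 : u <= 1 by rewrite ler_pdivrMr// mul1r ltW.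
  have Lu : L <= m.+2%:R * u.
    have -> : m.+2%:R * u = L / eps by rewrite /u; field; rewrite lt0r_neq0// -natrD pnatr_eq0.
    by rewrite ler_pdivlMr// ler_piMr// ltW.
  apply: (@le_trans _ _ ((1 - u) ^+ m.+2 * (1 + u) ^+ m.+2)).
    rewrite ler_wpM2l ?exprn_ge0 ?subr_ge0//.
    by apply: le_trans (bernoulli_ineq _ u0); rewrite lerD2l.
  rewrite -exprMn exprn_ile1//; nra.
have [A' [B' [hA hB bA bB]]] := layer_coefficients A B L0 r0 rL.
pose l1 : {poly R} := (1 + a / M)%:P + (- M^-1) *: 'X.
pose l2 : {poly R} := (1 - b / M)%:P + M^-1 *: 'X.
have dd (c0 c1 : R) : ((c0%:P + c1 *: 'X) ^+ m.+2)^`()^`() =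
    (m.+2%:R * m.+1%:R * c1 ^+ 2) *: (c0%:P + c1 *: 'X) ^+ m.
  by rewrite deriv_linear_exp derivZ deriv_linear_exp scalerA; congr (_ *: _); ring.
exists (A' *: l1 ^+ m.+2 + B' *: l2 ^+ m.+2).
have l1E x : l1.[x] = 1 - (x - a) / M by rewrite /l1 !hornerE; ring.
have l2E x : l2.[x] = 1 - (b - x) / M by rewrite /l2 !hornerE; ring.
split.
- apply: leq_trans (size_polyD _ _) _; rewrite geq_max.
  by rewrite !(leq_trans (size_scale_leq _ _))// size_linear_exp.
- rewrite hornerD !hornerZ !horner_exp l1E l2E subrr mul0r subr0 expr1n mulr1.
  by rewrite -/L -/r mulrC.
- rewrite hornerD !hornerZ !horner_exp l1E l2E subrr mul0r subr0 expr1n mulr1.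
  by rewrite -/L -/r mulrC.
move=> x; rewrite in_itv /= => /andP[ax xb].
rewrite !derivD !derivZ !dd -/l1 -/l2 !hornerD !hornerZ !horner_exp l1E l2E.
have [xa0 xaL] : 0 <= x - a /\ x - a <= L by rewrite /L; split; lra.
have [bx0 bxL] : 0 <= b - x /\ b - x <= L by rewrite /L; split; lra.
have := polynomial_layer_residual m e0 L0 xa0 xaL; rewrite /= -/M => h1.
have := polynomial_layer_residual m e0 L0 bx0 bxL; rewrite /= -/M => h2.
have s1 : 1 - (x - a) / L = (b - x) / L by rewrite /L; field; rewrite lt0r_neq0.
have s2 : 1 - (b - x) / L = (x - a) / L by rewrite /L; field; rewrite lt0r_neq0.
rewrite s1 in h1; rewrite s2 in h2.
set X1 := (_ - _) in h1; set X2 := (_ - _) in h2.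
rewrite (_ : _ - _ = A' * X1 + B' * X2); last first.
  by rewrite /X1 /X2 sqrrN exprVn; ring.
apply: le_trans (ler_normD _ _) _; rewrite !normrM.
set K := (1 + L^-1) * _ in bA bB *.
rewrite (_ : K * _ = K * (5 / m.+2%:R + ((b - x) / L) ^+ m) +
   K * (5 / m.+2%:R + ((x - a) / L) ^+ m)); last by ring.
by apply: lerD; exact: ler_pM.
Qed.

(** * Bernstein approximation and the layer-free part *)

(* The mean of [phi] under the binomial law with parameters [m] and ['X], by
   conditioning on the first trial: this avoids binomial coefficients. *)
Fixpoint bernstein (R : realType) (m : nat) (phi : nat -> R) : {poly R} :=
  if m is m'.+1 then
    (1 - 'X) * bernstein m' phi + 'X * bernstein m' (fun k => phi k.+1)
  else (phi 0)%:P.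

Lemma size_bernstein (R : realType) (m : nat) (phi : nat -> R) :
  (size (bernstein m phi) <= m.+1)%N.
Proof.
elim: m phi => [|m IH] phi /=; first exact: size_polyC_leq1.
apply: leq_trans (size_polyD _ _) _; rewrite geq_max.
have s1 : (size (1 - 'X : {poly R})%R <= 2)%N.
  by rewrite -opprB size_polyN -[1]/(1%:P) size_XsubC.
apply/andP; split; apply: leq_trans (size_polyMleq _ _) _.
  by have := IH phi; lia.
by rewrite size_polyX; have := IH (fun k => phi k.+1); lia.
Qed.

Lemma ler_bernstein (R : realType) (m : nat) (phi psi : nat -> R) (t : R) :
  0 <= t -> t <= 1 -> (forall k, (k <= m)%N -> phi k <= psi k) ->
  (bernstein m phi).[t] <= (bernstein m psi).[t].
Proof.
move=> t0 t1; elim: m phi psi => [|m IH] phi psi h /=.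
  by rewrite !hornerC; exact: h.
rewrite !hornerE; apply: lerD; apply: ler_wpM2l => //.
- by rewrite subr_ge0.
- by apply: IH => k km; apply: h; rewrite leqW.
- by apply: IH => k km; apply: h.
Qed.

(* Variance plus squared bias of the binomial law. *)
Lemma bernstein_sqr (R : realType) (m : nat) (al be c t : R) :
  (bernstein m (fun k => al + be * (k%:R - c) ^+ 2)).[t] =
  al + be * (m%:R * t * (1 - t) + (m%:R * t - c) ^+ 2).
Proof.
elim: m c => [|m IH] c /=; first by rewrite hornerC; ring.
have -> : (fun k : nat => al + be * (k.+1%:R - c) ^+ 2) =
    (fun k : nat => al + be * (k%:R - (c - 1)) ^+ 2).
  by apply/funext => k; rewrite -natr1; ring.
by rewrite !hornerE !IH -natr1; ring.
Qed.

(** The deviation at each node is majorized by a quadratic polynomial in [k], whose Bernstein mean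
    is known exactly by [bernstein_sqr]; monotonicity of the mean transfers the bound. This replaces
    the Cauchy-Schwarz step of the usual proof. *)
Lemma lipschitz_poly_approx (R : realType) (a b K : R) (g : R -> R) (m : nat) :
  a < b -> 0 <= K ->
  (forall x y, x \in `[a, b] -> y \in `[a, b] -> `|g x - g y| <= K * `|x - y|) ->
  exists s : {poly R}, (size s <= m.+1)%N /\
    forall x, x \in `[a, b] ->
      `|s.[x] - g x| <= 2 * (K * (b - a)) / Num.sqrt m.+2%:R.
Proof.
move=> ab K0 hg; have L0 : 0 < b - a by rewrite subr_gt0.
set L := b - a in L0 *.
set W : R := m.+2%:R.
have W0 : 0 < W by rewrite ltr0n.
have W2 : 2 <= W by rewrite ler_nat.
set sq := Num.sqrt W.
have s0 : 0 < sq by rewrite sqrtr_gt0.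
have sE : sq ^+ 2 = W by rewrite sqr_sqrtr// ltW.
(* Nodes [k / (m + 2)] rather than [k / m], to cover [m = 0]. *)
pose phi (k : nat) := g (a + L * (k%:R / W)).
exists (bernstein m phi \Po ((- (a / L))%:P + L^-1 *: 'X)); split.
  apply: leq_trans (size_comp_poly_leq _ _) _; rewrite ltnS.
  have h1 : (size ((- (a / L))%:P + L^-1 *: 'X)%R <= 2)%N.
    by have := size_linear_exp (- (a / L)) L^-1 1; rewrite expr1.
  apply: (@leq_trans ((size (bernstein m phi)).-1 * 1)%N).
    rewrite leq_mul2l; apply/orP; right; move: h1.
    by case: (size _) => [|[|[|k]]].
  by rewrite muln1; have := size_bernstein m phi; lia.
move=> x; rewrite in_itv /= => /andP[ax xb].
rewrite horner_comp hornerD hornerC hornerZ hornerX.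
set t := - (a / L) + _; have tE : t = (x - a) / L.
  by rewrite /t; ring.
have t0 : 0 <= t by rewrite tE divr_ge0 ?subr_ge0// ltW.
have t1 : t <= 1 by rewrite tE ler_pdivrMr// mul1r /L lerD2r.
have xE : x = a + L * t by rewrite tE mulrC mulfVK ?lt0r_neq0// addrC subrK.
have phiB (k : nat) : (k <= m)%N ->
    `|phi k - g x| <= K * L / (2 * sq) + K * L / (2 * sq * W) * (k%:R - W * t) ^+ 2.
  move=> km; have k0 : 0 <= k%:R / W by rewrite divr_ge0// ltW.
  have k1 : k%:R / W <= 1 by rewrite ler_pdivrMr// mul1r ler_nat !leqW.
  apply: le_trans (hg _ _ _ _) _.
  - rewrite in_itv /=; apply/andP; split.
      by rewrite lerDl mulr_ge0// ltW.
    by rewrite -lerBrDl -/L ler_piMr// ltW.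
  - by rewrite in_itv /= ax.
  rewrite {1}xE opprD addrACA subrr add0r -mulrBr normrM (gtr0_norm L0).
  have -> : k%:R / W - t = (k%:R - W * t) / W by field; rewrite lt0r_neq0.
  rewrite normrM normfV (gtr0_norm W0); set z := `|k%:R - W * t|.
  have -> : (k%:R - W * t) ^+ 2 = z ^+ 2 by rewrite /z real_normK// num_real.
  have -> : K * (L * (z / W)) = K * L / (2 * sq) * (2 * (z / sq)).
    by rewrite -sE; field; rewrite lt0r_neq0.
  have -> : K * L / (2 * sq) + K * L / (2 * sq * W) * z ^+ 2 =
      K * L / (2 * sq) * (1 + (z / sq) ^+ 2).
    by rewrite -sE; field; rewrite lt0r_neq0.
  rewrite ler_wpM2l ?divr_ge0 ?mulr_ge0 ?(ltW L0) ?(ltW s0)//.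
  (* This is 2s <= 1 + s^2 for s = z / sqrt W, the scaling that balances the two terms of the
     majorant. *)
  by have := sqr_ge0 (1 - z / sq); rewrite expr2 => h; rewrite expr2; lra.
set al := K * L / (2 * sq) in phiB; set be := K * L / (2 * sq * W) in phiB.
have be0 : 0 <= be.
  by rewrite /be divr_ge0 ?mulr_ge0 ?(ltW L0) ?(ltW s0) ?(ltW W0).
have V : al + be * (m%:R * t * (1 - t) + (m%:R * t - W * t) ^+ 2) <=
    2 * (K * L) / sq.
  have mW : m%:R = W - 2 :> R by rewrite /W -natr1 -natr1; ring.
  (* The variance is at most (W - 2)/4 and the squared bias (2t)^2 at most 4; their sum is below 3W
     because W >= 2. *)
  apply: (@le_trans _ _ (al + be * (3 * W))); last first.
    rewrite /al /be le_eqVlt; apply/orP; left; apply/eqP.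
    by field; rewrite !lt0r_neq0.
  rewrite lerD2l ler_wpM2l// mW.
  rewrite (_ : (W - 2) * t - W * t = - (2 * t)); last by ring.
  have tt : 0 <= t * (1 - t) by rewrite mulr_ge0// subr_ge0.
  have tt4 : t * (1 - t) <= 1 / 4.
    by have := sqr_ge0 (t - 1 / 2); rewrite expr2; lra.
  have : (W - 2) * (t * (1 - t)) <= (W - 2) * (1 / 4) by rewrite ler_wpM2l//; lra.
  have : t * t <= 1 by rewrite mulr_ile1.
  by rewrite sqrrN expr2; lra.
apply: le_trans V; rewrite ler_norml; apply/andP; split.
  rewrite lerNl opprB lerBlDr -lerBlDl.
  rewrite (_ : g x - _ = g x - al + (- be) *
    (m%:R * t * (1 - t) + (m%:R * t - W * t) ^+ 2)); last by ring.
  rewrite -bernstein_sqr; apply: ler_bernstein => // k km.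
  by have := phiB k km; rewrite ler_norml => /andP[h _]; lra.
rewrite lerBlDl addrA -bernstein_sqr; apply: ler_bernstein => // k km.
by have := phiB k km; rewrite ler_norml => /andP[_ h]; lra.
Qed.

Lemma poly_antiderivative (R : realType) (s : {poly R}) :
  exists S : {poly R}, S^`() = s /\ (size S <= (size s).+1)%N.
Proof.
(* At index 0 the division by zero yields 0, the constant of integration. *)
exists (\poly_(i < (size s).+1) (s`_i.-1 / i%:R)); split; last exact: size_poly.
apply/polyP => i; rewrite coef_deriv coef_poly ltnS.
case: ltnP => [_|h]; last by rewrite mul0rn nth_default.
by rewrite /= -(mulr_natr (s`_i / _)) mulfVK// pnatr_eq0.
Qed.

Lemma poly_second_antiderivative (R : realType) (a b A B : R) (s : {poly R})
    (m : nat) : a < b -> (size s <= m.+1)%N ->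
  exists q : {poly R}, [/\ q^`()^`() = s, q.[a] = A, q.[b] = B &
    (size q <= m.+3)%N].
Proof.
move=> ab sm; have ba0 : b - a != 0 by rewrite lt0r_neq0// subr_gt0.
have [S1 [dS1 z1]] := poly_antiderivative s.
have [S2 [dS2 z2]] := poly_antiderivative S1.
(* An affine correction adjusts both end values without changing the second derivative. *)
pose c1 := ((B - S2.[b]) - (A - S2.[a])) / (b - a).
exists (S2 + (((A - S2.[a]) - c1 * a)%:P + c1 *: 'X)); split.
- have -> : (S2 + ((A - S2.[a] - c1 * a)%:P + c1 *: 'X))^`() = S1 + c1%:P.
    by rewrite derivD derivD derivC add0r derivZ derivX alg_polyC dS2.
  by rewrite derivD derivC addr0.
- by rewrite !hornerD hornerC hornerZ hornerX; ring.
- by rewrite !hornerD hornerC hornerZ hornerX /c1; field.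
have h1 := size_linear_exp (A - S2.[a] - c1 * a) c1 1; rewrite expr1 in h1.
apply: leq_trans (size_polyD _ _) _; rewrite geq_max; apply/andP; split; lia.
Qed.

(** With [y] the exponential layer, [u = U - y] is split as [f + eps^2 f'' + w]. Here [w] vanishes
    at both ends and [w - eps^2 w'' = eps^4 f''''], so the maximum principle gives [w = O(eps^4)];
    the equation then gives [w'' = O(eps^2)], hence [w' = O(eps^2)]. Therefore
    [u'' = f'' + w / eps^2] has a Lipschitz constant free of [eps]. *)
Lemma regular_part (R : realType) (a b alpha beta : R) (f : R -> R) :
  a < b -> analytic_on `[a, b] f ->
  exists2 C, 0 <= C & forall (eps : R) (U : R -> R) (m : nat),
    0 < eps -> eps <= 1 -> exact_solution a b alpha beta eps f U ->
    exists q : {poly R}, [/\ (size q <= m.+3)%N, `|q.[a]| <= C, `|q.[b]| <= C &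
      forall x, x \in `]a, b[ ->
        `|q.[x] - eps ^+ 2 * q^`()^`().[x] - f x| <= C / Num.sqrt m.+2%:R].
Proof.
move=> ab hf; have L0 : 0 < b - a by rewrite subr_gt0.
have ooc x : x \in `]a, b[ -> x \in `[a, b].
  by rewrite !in_itv /= => /andP[/ltW -> /ltW ->].
have aab : a \in `[a, b] by rewrite in_itv /= lexx ltW.
have bab : b \in `[a, b] by rewrite in_itv /= lexx ltW.
have [F0 F0p hF0] := analytic_derive1n_bounded 0 (ltW ab) hf.
have [F2 F2p hF2] := analytic_derive1n_bounded 2 (ltW ab) hf.
have [F3 F3p hF3] := analytic_derive1n_bounded 3 (ltW ab) hf.
have [F4 F4p hF4] := analytic_derive1n_bounded 4 (ltW ab) hf.
have df n x : x \in `[a, b] -> is_derive x 1 (derive1n n f) (derive1n n.+1 f x).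
  by move=> xab; exact: (analytic_derive1n n hf xab).
set L := b - a in L0 *.
(* Bound on [u''']: [F3] for [f'''] and [2 F4 L] for [w' / eps^2]. *)
pose K := F3 + 2 * F4 * L.
have K0 : 0 <= K by rewrite /K addr_ge0// !mulr_ge0// ltW.
pose D := 2 * (K * L) * (1 + L ^+ 2).
have D0 : 0 <= D.
  by rewrite /D mulr_ge0 ?addr_ge0 ?sqr_ge0// mulr_ge0// mulr_ge0// ltW.
exists (F0 + F2 + D); first by rewrite !addr_ge0.
move=> eps U m e0 e1 [cU hU _ _].
have ee0 : 0 < eps ^+ 2 by rewrite exprn_gt0.
have en0 : eps != 0 by rewrite lt0r_neq0.
have een0 : eps ^+ 2 != 0 by rewrite lt0r_neq0.
have ee1 : eps ^+ 2 <= 1 by rewrite exprn_ile1// ltW.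
pose f2 := derive1n 2 f; pose f3 := derive1n 3 f; pose f4 := derive1n 4 f.
have [y [y1 [dy dy1 ya yb _]]] := exp_layer (U a - f a - eps ^+ 2 * f2 a)
  (U b - f b - eps ^+ 2 * f2 b) ab e0 e1.
pose h x := y x + f x + eps ^+ 2 * f2 x.
pose w x := U x - h x.
pose w1 x := derive1 U x - (y1 x + derive1 f x + eps ^+ 2 * f3 x).
pose w2 x := derive1n 2 U x - (y x / eps ^+ 2 + f2 x + eps ^+ 2 * f4 x).
have dh x : x \in `[a, b] ->
    is_derive x 1 h (y1 x + derive1 f x + eps ^+ 2 * f3 x).
  move=> xab; have h0 := df 0 x xab; have h2 := df 2 x xab; have hy := dy x.
  by apply: is_derive_eq.
have ch : {within `[a, b], continuous h}.
  by apply: derivable_within_continuous => x /dh [].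
have cw : {within `[a, b], continuous w} := within_continuousB cU ch.
have dU x : x \in `]a, b[ -> is_derive x 1 U (derive1 U x).
  by move=> /hU[hd _ _]; rewrite derive1E; exact: derivableP.
have dU1 x : x \in `]a, b[ -> is_derive x 1 (derive1 U) (derive1n 2 U x).
  by move=> /hU[_ hd _]; rewrite derive1nS derive1E derive1n1; exact: derivableP.
have dw x : x \in `]a, b[ -> is_derive x 1 w (w1 x).
  move=> xab; have h1 := dU x xab; have h2 := dh x (ooc x xab).
  by apply: is_derive_eq.
have dw1 x : x \in `]a, b[ -> is_derive x 1 w1 (w2 x).
  move=> xab; have h1 := dU1 x xab; have h2 := df 1 x (ooc x xab).
  have h3 := df 3 x (ooc x xab); have hy := dy1 x.
  exact: (is_deriveB h1 (is_deriveD (is_deriveD hy h2) (is_deriveZ (eps ^+ 2) h3))).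
have wa : w a = 0 by rewrite /w /h ya; ring.
have wb : w b = 0 by rewrite /w /h yb; ring.
have odew x : x \in `]a, b[ -> w x - eps ^+ 2 * w2 x = eps ^+ 4 * f4 x.
  move=> /hU[_ _ e]; rewrite /w /w2 /h -e; field.
  exact: en0.
have hw : forall x, x \in `[a, b] -> `|w x| <= eps ^+ 4 * F4.
  apply: (max_principle ab cw dw dw1 ee0 wa wb) => x xab; rewrite odew//.
  rewrite normrM ger0_norm ?exprn_ge0 ?(ltW e0)//.
  by rewrite ler_wpM2l ?exprn_ge0 ?(ltW e0)//; apply/hF4/ooc.
have hw2 x : x \in `]a, b[ -> `|w2 x| <= 2 * eps ^+ 2 * F4.
  move=> xab; rewrite -(ler_pM2l ee0).
  have -> : eps ^+ 2 * `|w2 x| = `|w x - eps ^+ 4 * f4 x|.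
    rewrite -odew// opprB addrCA subrr addr0 normrM ger0_norm//; exact: ltW.
  apply: le_trans (ler_normB _ _) _.
  have -> : eps ^+ 2 * (2 * eps ^+ 2 * F4) = eps ^+ 4 * F4 + eps ^+ 4 * F4 by ring.
  apply: lerD; first exact/hw/ooc.
  rewrite normrM ger0_norm ?exprn_ge0 ?(ltW e0)//.
  by rewrite ler_wpM2l ?exprn_ge0 ?(ltW e0)//; apply/hF4/ooc.
have [hw1 _] := second_derivative_bound ab cw dw dw1 wa wb hw2.
(* [g] is [u''], expressed through [w] so that it is continuous up to the end points. *)
pose g x := f2 x + (eps ^+ 2)^-1 * w x.
have cg : {within `[a, b], continuous g}.
  have c2 : {within `[a, b], continuous f2}.
    by apply: derivable_within_continuous => x xab; have [] := df 2 x xab.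
  move=> x; apply: cvgD; first exact: c2.
  by apply: cvgM; [exact: cvg_cst | exact: cw].
have Lg x z : x \in `[a, b] -> z \in `[a, b] -> `|g x - g z| <= K * `|x - z|.
  move=> xab zab.
  apply: (@derive_bound_lipschitz _ _ g (fun t => f3 t + (eps ^+ 2)^-1 * w1 t) K x z cg)
    => // t /(between_itvoo xab zab) tab.
    have h1 := df 2 t (ooc t tab); have h2 := dw t tab.
    exact: (is_deriveD h1 (is_deriveZ (eps ^+ 2)^-1 h2)).
  apply: le_trans (ler_normD _ _) _; rewrite /K; apply: lerD; first exact/hF3/ooc.
  rewrite normrM normfV (gtr0_norm ee0) mulrC ler_pdivrMr//.
  apply: le_trans (hw1 t tab) _.
  by rewrite -/L (_ : 2 * eps ^+ 2 * F4 * L = 2 * F4 * L * eps ^+ 2)//; ring.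
have [s [zs hs]] := lipschitz_poly_approx m ab K0 Lg.
have [q [dq qa qb zq]] := poly_second_antiderivative
  (f a + eps ^+ 2 * f2 a) (f b + eps ^+ 2 * f2 b) ab zs.
have bnd x : x \in `[a, b] -> `|f x + eps ^+ 2 * f2 x| <= F0 + F2 + D.
  move=> xab; apply: (@le_trans _ _ (F0 + F2)); last by rewrite lerDl.
  apply: le_trans (ler_normD _ _) _; apply: lerD; first exact: (hF0 x xab).
  rewrite normrM (gtr0_norm ee0); apply: le_trans (hF2 x xab).
  by rewrite ler_piMl.
exists q; split => //; [by rewrite qa; exact: bnd | by rewrite qb; exact: bnd |].
move=> x xab.
set dl := 2 * (K * L) / Num.sqrt m.+2%:R.
(* [d] is [u - q]: it vanishes at both ends and its second derivative is the Bernstein error, so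
   [second_derivative_bound] controls it. *)
pose d t := U t - (y t + q.[t]).
pose d1 t := derive1 U t - (y1 t + q^`().[t]).
pose d2 t := derive1n 2 U t - (y t / eps ^+ 2 + q^`()^`().[t]).
have cd : {within `[a, b], continuous d}.
  apply: within_continuousB cU _; apply: derivable_within_continuous => t _.
  by have hy := dy t; have hq := is_derive_poly q t; apply: ex_derive.
have dd t : t \in `]a, b[ -> is_derive t 1 d (d1 t).
  move=> tab; have h1 := dU t tab; have hy := dy t; have hq := is_derive_poly q t.
  by apply: is_derive_eq.
have dd1 t : t \in `]a, b[ -> is_derive t 1 d1 (d2 t).
  move=> tab; have h1 := dU1 t tab; have hy := dy1 t.
  have hq := is_derive_poly q^`() t.
  by apply: is_derive_eq.
have d2E t : t \in `]a, b[ -> d2 t = g t - s.[t].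
  move=> /hU[_ _ e]; rewrite /d2 dq /g /w /h.
  have -> : derive1n 2 U t = (U t - f t) / eps ^+ 2 by rewrite -e; field; exact: en0.
  by field; exact: en0.
have hd2 t : t \in `]a, b[ -> `|d2 t| <= dl.
  by move=> tab; rewrite d2E// distrC; apply/hs/ooc.
have da : d a = 0 by rewrite /d ya qa; ring.
have db : d b = 0 by rewrite /d yb qb; ring.
have [_ hd] := second_derivative_bound ab cd dd dd1 da db hd2.
have -> : q.[x] - eps ^+ 2 * q^`()^`().[x] - f x = eps ^+ 2 * (g x - s.[x]) - d x.
  by rewrite dq /d /g /w /h; field; exact: en0.
apply: (@le_trans _ _ (dl + dl * L ^+ 2)).
  apply: le_trans (ler_normB _ _) _; apply: lerD; last exact/hd/ooc.
  rewrite normrM (gtr0_norm ee0) -d2E//; apply: le_trans (hd2 x xab).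
  by rewrite ler_piMl.
rewrite (_ : dl + dl * L ^+ 2 = D / Num.sqrt m.+2%:R); last by rewrite /dl /D; ring.
by rewrite ler_wpM2r ?invr_ge0 ?sqrtr_ge0// lerDr addr_ge0.
Qed.

(** * A polynomial with small residual *)

Lemma derive1n2_horner (R : realType) (p : {poly R}) :
  derive1n 2 (horner p) = horner p^`()^`().
Proof. by rewrite derive1nS derive1n1 !derivE. Qed.

(** Integrating the squared layer profiles, of degree [2m], produces the factor 1/(2m + 1): this is
    the gain of 1/W in the unresolved regime. *)
Lemma layer_sqr_primitive (R : realType) (a b D E : R) (m : nat) : a < b ->
  exists Psi : {poly R}, (forall x, Psi^`().[x] =
     D + E * (((b - x) / (b - a)) ^+ m.*2 + ((x - a) / (b - a)) ^+ m.*2)) /\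
   Psi.[b] - Psi.[a] = D * (b - a) + E * (2 * (b - a) / m.*2.+1%:R).
Proof.
move=> ab; have Ln0 : b - a != 0 by rewrite lt0r_neq0// subr_gt0.
have n0 : m.*2.+1%:R != 0 :> R by rewrite pnatr_eq0.
set L := b - a in Ln0 *; set n : R := m.*2.+1%:R in n0 *.
pose l1 : {poly R} := (- (a / L))%:P + L^-1 *: 'X.
pose l2 : {poly R} := (b / L)%:P + (- L^-1) *: 'X.
have l1E x : l1.[x] = (x - a) / L.
  by rewrite hornerD hornerC hornerZ hornerX; ring.
have l2E x : l2.[x] = (b - x) / L.
  by rewrite hornerD hornerC hornerZ hornerX; ring.
exists (D *: 'X + (E * (L / n)) *: (l1 ^+ m.*2.+1 - l2 ^+ m.*2.+1)); split=> [x|].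
  rewrite derivD !derivZ derivX derivB !deriv_linear_exp -/l1 -/l2 -/n.
  rewrite !hornerD !hornerZ hornerD hornerN !hornerZ !horner_exp hornerC l1E l2E.
  by field; apply/andP.
rewrite !hornerD !hornerZ !hornerX !hornerD !hornerN !horner_exp.
rewrite !l1E !l2E -/L !subrr mul0r divff// !expr0n /= !expr1n /L.
by move: n n0 {l1 l2 l1E l2E} => n n0; field.
Qed.

Lemma continuous_residual (R : realType) (a b eps : R) (f : R -> R) (p : {poly R}) :
  analytic_on `[a, b] f -> forall x, x \in `[a, b] ->
  {for x, continuous (fun x => p.[x] - eps ^+ 2 * p^`()^`().[x] - f x)}.
Proof.
move=> hf x xab; apply: continuousB.
  apply: continuousB; first exact: continuous_horner.
  by apply: continuousM; [exact: cst_continuous | exact: continuous_horner].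
exact: is_derive_continuous (analytic_derive1n 0 hf xab).
Qed.

Lemma residualE (R : realType) (a b alpha beta eps : R) (f : R -> R) (p : {poly R}) :
  residual a b alpha beta eps f (horner p) =
  (\int[lebesgue_measure]_(x in `]a, b[)
     (((p.[x] - eps ^+ 2 * p^`()^`().[x] - f x) ^+ 2)%R)%:E
   + ((p.[a] - alpha) ^+ 2 + (p.[b] - beta) ^+ 2)%:E)%E.
Proof.
rewrite /residual L2norm_sq derive1n2_horner EFinD addeA !real_normK ?num_real//.
congr (_ + _ + _)%E; apply: eq_integral => x _; congr EFin; ring.
Qed.

Lemma residual_upper_bound (R : realType) (a b alpha beta : R) (f : R -> R) :
  a < b -> analytic_on `[a, b] f ->
  exists2 C, 0 <= C & forall (eps : R) (U : R -> R) (m : nat),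
    0 < eps -> eps <= 1 -> exact_solution a b alpha beta eps f U ->
    exists p : {poly R}, (size p <= m.+3)%N /\
      (residual a b alpha beta eps f (horner p) <= (C / m.+2%:R)%:E)%E.
Proof.
move=> ab hf; have L0 : 0 < b - a by rewrite subr_gt0.
have hn (k : nat) : (k.+2 <= 2 * k.*2.+1)%N by rewrite -addnn; lia.
have [C1 C10 hC1] := regular_part alpha beta ab hf.
pose K := 1 + (b - a)^-1; pose S := `|alpha| + `|beta| + 2 * C1.
have K0 : 0 <= K by rewrite addr_ge0// invr_ge0 ltW.
have S0 : 0 <= S by rewrite !addr_ge0// mulr_ge0.
(* [S] bounds the layer amplitudes. [C2] collects the errors of [q] and [P], since 1/W <= W^(-1/2)
   lets the term 10/W of the layer join the Bernstein error. *)
pose C2 := C1 + 10 * (K * S).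
have C20 : 0 <= C2 by rewrite addr_ge0// mulr_ge0// mulr_ge0.
(* The square of a sum of three terms costs 3. The term W^(-1/2) contributes 3/W and the two
   profiles 6/(2m + 1) <= 12/W, by [hn]. *)
exists (15 * C2 ^+ 2 * (b - a)).
  by rewrite mulr_ge0 ?(ltW L0)// mulr_ge0// sqr_ge0.
move=> eps U m e0 e1 hU.
have [q [zq qa qb hq]] := hC1 eps U m e0 e1 hU.
have [P [zP Pa Pb hP]] := polynomial_layer (alpha - q.[a]) (beta - q.[b]) m ab e0 e1.
exists (q + P); split.
  by apply: leq_trans (size_polyD _ _) _; rewrite geq_max zq zP.
rewrite residualE !hornerD Pa Pb.
(* [P] carries exactly the boundary defect of [q], so the boundary part of the residual is zero. *)
rewrite (_ : q.[a] + _ - alpha = 0); last by ring.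
rewrite (_ : q.[b] + _ - beta = 0); last by ring.
rewrite expr0n /= addr0 adde0.
set W : R := m.+2%:R.
have W0 : 0 < W by rewrite ltr0n.
have W1 : 1 <= W by rewrite ler1n.
set sq := Num.sqrt W.
have s0 : 0 < sq by rewrite sqrtr_gt0.
have sE : sq ^+ 2 = W by rewrite sqr_sqrtr// ltW.
have s1 : 1 <= sq by rewrite -[leLHS]sqrtr1 ler_wsqrtr.
pose ta x := ((x - a) / (b - a)) ^+ m; pose tb x := ((b - x) / (b - a)) ^+ m.
have pw x : x \in `]a, b[ ->
    `|(q + P).[x] - eps ^+ 2 * (q + P)^`()^`().[x] - f x| <=
    C2 * (sq^-1 + tb x + ta x).
  move=> xab; rewrite !derivD !hornerD.
  have xab' : x \in `[a, b] by move: xab; rewrite !in_itv /= => /andP[/ltW -> /ltW ->].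
  have := hq x xab; have := hP x xab'.
  set X := P.[x] - _; set Y := q.[x] - _ - _ => hX hY.
  rewrite (_ : _ - _ - _ = X + Y); last by rewrite /X /Y; ring.
  apply: le_trans (ler_normD _ _) _.
  have tt : 0 <= tb x + ta x.
    move: xab'; rewrite in_itv /= => /andP[ax xb].
    by rewrite addr_ge0// exprn_ge0// divr_ge0 ?subr_ge0// ltW.
  have hS : `|alpha - q.[a]| + `|beta - q.[b]| <= S.
    rewrite /S; have := ler_normB alpha q.[a]; have := ler_normB beta q.[b]; lra.
  have iW : W^-1 <= sq^-1.
    rewrite -sE lef_pV2 ?posrE ?exprn_gt0// expr2 ler_pMl//.
  have hX' : `|X| <= K * S * (10 * sq^-1 + (tb x + ta x)).
    apply: le_trans hX _; rewrite -addrA; apply: ler_pM => //.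
    - by rewrite mulr_ge0// addr_ge0.
    - by rewrite addr_ge0// divr_ge0// ltW.
    - by rewrite ler_wpM2l.
    - by rewrite lerD2r ler_wpM2l.
  apply: le_trans (lerD hX' hY) _.
  have KS : 0 <= K * S by rewrite mulr_ge0.
  have h1 : 0 <= (C1 + 9 * (K * S)) * (tb x + ta x).
    by rewrite mulr_ge0// addr_ge0// mulr_ge0.
  rewrite -subr_ge0 (_ : _ - _ = (C1 + 9 * (K * S)) * (tb x + ta x))//.
  by rewrite /C2; ring.
have [Psi [dPsi PsiE]] :=
  layer_sqr_primitive (3 * C2 ^+ 2 / W) (3 * C2 ^+ 2) m ab.
apply: (@le_trans _ _ (\int[lebesgue_measure]_(x in `]a, b[)
   (3 * C2 ^+ 2 / W + 3 * C2 ^+ 2 *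
     (((b - x) / (b - a)) ^+ m.*2 + ((x - a) / (b - a)) ^+ m.*2))%:E)%E).
  apply: ge0_le_integral => //.
  - by move=> x _; rewrite lee_fin sqr_ge0.
  - apply: measurable_sqr_continuous => x xab.
    have xab' : x \in `[a, b].
      by move: xab; rewrite !in_itv /= => /andP[/ltW -> /ltW ->].
    exact: (continuous_residual hf xab').
  - apply/measurable_EFinP; apply: open_continuous_measurable_fun.
      exact: interval_open.
    by move=> x _; under eq_fun do rewrite -dPsi; exact: continuous_horner.
  - move=> x xab; rewrite lee_fin.
    have := pw x xab; set Z := _ - f x => hZ.
    rewrite -(real_normK (num_real Z)).
    apply: (@le_trans _ _ ((C2 * (sq^-1 + tb x + ta x)) ^+ 2)).
      by rewrite lerXn2r// nnegrE (le_trans _ hZ).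
    rewrite -addnn !exprD -/(ta x) -/(tb x) -sE.
    have := sqr_ge0 C2; set c := C2 ^+ 2 => c0.
    rewrite exprMn -/c (_ : 3 * c / sq ^+ 2 + _ =
      c * (3 * (sq^-1 ^+ 2 + tb x * tb x + ta x * ta x))); last first.
      by rewrite exprVn; ring.
    rewrite ler_wpM2l//; move: (sq^-1) (tb x) (ta x) => r s t.
    have := sqr_ge0 (r - s); have := sqr_ge0 (s - t); have := sqr_ge0 (r - t).
    rewrite !expr2; lra.
rewrite -(@integral_itv_bndoo _ _ _ _ true false); last first.
  apply/measurable_EFinP; apply: open_continuous_measurable_fun.
    exact: interval_open.
  by move=> x _; under eq_fun do rewrite -dPsi; exact: continuous_horner.
under eq_integral do rewrite -dPsi.
rewrite (@FTC2_is_derive _ a b (horner Psi)) //; last first.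
  by move=> x _; exact: continuous_horner.
rewrite PsiE lee_fin.
have n0 : 0 < m.*2.+1%:R :> R by [].
have Wn : (m.*2.+1%:R)^-1 <= 2 / W.
  rewrite ler_pdivlMr// mulrC ler_pdivrMr// /W -natrM ler_nat; exact: hn.
have c0 : 0 <= C2 ^+ 2 * (b - a) by rewrite mulr_ge0 ?sqr_ge0// ltW.
have h := ler_wpM2l c0 Wn.
rewrite (_ : 3 * C2 ^+ 2 * (2 * (b - a) / m.*2.+1%:R) =
  6 * (C2 ^+ 2 * (b - a) * (m.*2.+1%:R)^-1)); last by ring.
rewrite (_ : 15 * C2 ^+ 2 * (b - a) / W = 3 * C2 ^+ 2 / W * (b - a) +
  6 * (C2 ^+ 2 * (b - a) * (2 / W))); last by ring.
by rewrite lerD2l ler_wpM2l.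
Qed.

(** * Stability *)

(** [v1] and [v2] stand for the derivatives on the open interval only, and the three norms merge
    into one integral that can be compared pointwise with the energy density. *)
Lemma norm2eps_sqE (R : realType) (a b eps : R) (v v1 v2 : R -> R) :
  {in `]a, b[, continuous v} -> {in `]a, b[, continuous v1} ->
  {in `]a, b[, continuous v2} ->
  (forall x, x \in `]a, b[ -> is_derive x 1 v (v1 x)) ->
  (forall x, x \in `]a, b[ -> is_derive x 1 v1 (v2 x)) ->
  norm2eps_sq a b eps v = (\int[lebesgue_measure]_(x in `]a, b[)
    ((v x ^+ 2 + (eps * v1 x) ^+ 2 + (eps ^+ 2 * v2 x) ^+ 2)%R)%:E)%E.
Proof.
move=> cv cv1 cv2 dv dv1.
have e1 x : x \in `]a, b[ -> derive1 v x = v1 x.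
  by move=> /dv h; rewrite derive1E derive_val.
have e2 x : x \in `]a, b[ -> derive1n 2 v x = v2 x.
  move=> xab; have h := dv1 x xab.
  rewrite derive1nS derive1n1 derive1E.
  rewrite (@near_eq_derive _ _ _ _ v1); first by rewrite derive_val.
  by near=> t; apply: e1; near: t; exact: near_in_itvoo.
rewrite /norm2eps_sq !big_ord_recr big_ord0 /= add0e -!expe2 !L2norm_sq.
have -> : (\int[lebesgue_measure]_(x in `]a, b[) ((derive1n 1 v x ^+ 2)%R)%:E =
    \int[lebesgue_measure]_(x in `]a, b[) ((v1 x ^+ 2)%R)%:E)%E.
  by apply: eq_integral => x; rewrite inE => xab; rewrite derive1n1 e1.
have -> : (\int[lebesgue_measure]_(x in `]a, b[) ((derive1n 2 v x ^+ 2)%R)%:E =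
    \int[lebesgue_measure]_(x in `]a, b[) ((v2 x ^+ 2)%R)%:E)%E.
  by apply: eq_integral => x; rewrite inE => xab; rewrite e2.
have scale (c : R) (u : R -> R) : {in `]a, b[, continuous u} ->
    ((c ^+ 2)%:E * \int[lebesgue_measure]_(x in `]a, b[) ((u x ^+ 2)%R)%:E =
     \int[lebesgue_measure]_(x in `]a, b[) (((c * u x) ^+ 2)%R)%:E)%E.
  move=> cu; rewrite -ge0_integralZl_EFin ?sqr_ge0//.
  - by apply: eq_integral => x _; rewrite -EFinM exprMn.
  - by move=> x _; rewrite lee_fin sqr_ge0.
  - exact: measurable_sqr_continuous.
have cM (c : R) (u : R -> R) : {in `]a, b[, continuous u} ->
    {in `]a, b[, continuous (fun x => c * u x)}.
  by move=> cu x xab; apply: continuousM; [exact: cst_continuous | exact: cu].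
rewrite (_ : eps ^+ (2 * 0) = 1 ^+ 2) ?muln0 ?expr0 ?expr1n// mul1e.
rewrite (_ : eps ^+ (2 * 1) = eps ^+ 2)// (_ : eps ^+ (2 * 2) = (eps ^+ 2) ^+ 2);
  last by rewrite exprM.
rewrite (scale eps _ cv1) (scale (eps ^+ 2) _ cv2).
have m0 := measurable_sqr_continuous cv.
have m1 := measurable_sqr_continuous (cM eps _ cv1).
have m2 := measurable_sqr_continuous (cM (eps ^+ 2) _ cv2).
rewrite -ge0_integralD//; try by move=> x _; rewrite lee_fin sqr_ge0.
rewrite -ge0_integralD//.
- by move=> x _; rewrite -EFinD lee_fin addr_ge0 ?sqr_ge0.
- by apply/measurable_EFinP; apply: measurable_funD; exact/measurable_EFinP.
- by move=> x _; rewrite lee_fin sqr_ge0.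
Unshelve. all: by end_near. Qed.

(** For [v = z - U], the residual function [g] of [z] equals [v - eps^2 v'']. Subtracting the layer
    [y] with the end values of [v] leaves [g] unchanged, because [y = eps^2 y''], and makes the
    energy estimate applicable; the size of [y] is governed by the boundary part of the residual. *)
Lemma stability (R : realType) (a b alpha beta eps : R) (f U : R -> R) (z : {poly R}) :
  a < b -> analytic_on `[a, b] f -> 0 < eps -> eps <= 1 ->
  exact_solution a b alpha beta eps f U ->
  (norm2eps_sq a b eps (fun x => (z.[x] - U x)%R) <=
   (2 + 48 * (1 + (b - a)^-1) ^+ 2 * (b - a))%:E *
     residual a b alpha beta eps f (horner z))%E.
Proof.
move=> ab hf e0 e1 [cU hU Ua Ub]; have L0 : 0 < b - a by rewrite subr_gt0.
have ee0 : 0 < eps ^+ 2 by rewrite exprn_gt0.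
have en0 : eps != 0 by rewrite lt0r_neq0.
have ooc x : x \in `]a, b[ -> x \in `[a, b].
  by rewrite !in_itv /= => /andP[/ltW -> /ltW ->].
have cUoo x : x \in `]a, b[ -> {for x, continuous U}.
  exact: within_continuous_continuous.
have dU x : x \in `]a, b[ -> is_derive x 1 U (derive1 U x).
  by move=> /hU[hd _ _]; rewrite derive1E; exact: derivableP.
have dU1 x : x \in `]a, b[ -> is_derive x 1 (derive1 U) ((U x - f x) / eps ^+ 2).
  move=> /hU[_ hd e]; rewrite (_ : _ / _ = derive1n 2 U x).
    by rewrite derive1nS derive1E derive1n1; exact: derivableP.
  by rewrite -e; field.
have df x : x \in `[a, b] -> is_derive x 1 f (derive1n 1 f x).
  by move=> xab; exact: (analytic_derive1n 0 hf xab).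
pose g x := z.[x] - eps ^+ 2 * z^`()^`().[x] - f x.
pose v x := z.[x] - U x.
pose v1 x := z^`().[x] - derive1 U x.
pose v2 x := z^`()^`().[x] - (U x - f x) / eps ^+ 2.
have dv x : x \in `]a, b[ -> is_derive x 1 v (v1 x).
  by move=> xab; exact: (is_deriveB (is_derive_poly z x) (dU x xab)).
have dv1 x : x \in `]a, b[ -> is_derive x 1 v1 (v2 x).
  by move=> xab; exact: (is_deriveB (is_derive_poly z^`() x) (dU1 x xab)).
have cv x : x \in `]a, b[ -> {for x, continuous v}.
  by move/dv; exact: is_derive_continuous.
have cv1 x : x \in `]a, b[ -> {for x, continuous v1}.
  by move/dv1; exact: is_derive_continuous.
have cv2 x : x \in `]a, b[ -> {for x, continuous v2}.
  move=> xab; apply: continuousB; first exact: continuous_horner.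
  apply: continuousM; last exact: cst_continuous.
  by apply: continuousB (cUoo x xab) (is_derive_continuous (df x (ooc x xab))).
rewrite (norm2eps_sqE eps cv cv1 cv2 dv dv1).
have [y [y1 [dy dy1 ya yb hy]]] := exp_layer (v a) (v b) ab e0 e1.
set Y := 2 * _ * _ in hy.
pose v0 x := v x - y x; pose v01 x := v1 x - y1 x.
have dv0 x : x \in `]a, b[ -> is_derive x 1 v0 (v01 x).
  by move=> xab; exact: (is_deriveB (dv x xab) (dy x)).
have dv01 x : x \in `]a, b[ -> is_derive x 1 v01 ((v0 x - g x) / eps ^+ 2).
  move=> xab; rewrite (_ : _ / _ = v2 x - y x / eps ^+ 2).
    exact: (is_deriveB (dv1 x xab) (dy1 x)).
  by rewrite /v0 /g /v /v2; field.
have cv0 : {within `[a, b], continuous v0}.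
  apply: within_continuousB; last first.
    by apply: derivable_within_continuous => x _; have [] := dy x.
  apply: within_continuousB cU.
  by apply: derivable_within_continuous => x _; have [] := is_derive_poly z x.
have cg : {within `[a, b], continuous g}.
  by apply: continuous_in_subspaceT => x; rewrite inE; exact: continuous_residual.
have v0a : v0 a = 0 by rewrite /v0 ya subrr.
have v0b : v0 b = 0 by rewrite /v0 yb subrr.
have hE := energy_bound ab ee0 cv0 cg dv0 dv01 v0a v0b.
have cE := continuous_energy_density ab cv0 cg dv01.
set E := energy_density _ _ _ _ in hE cE.
have E0 x : 0 <= E x.
  rewrite /E /energy_density addr_ge0 ?sqr_ge0// addr_ge0 ?sqr_ge0//.
  by rewrite mulr_ge0 ?sqr_ge0// mulr_ge0// ltW.
have mE : measurable_fun `]a, b[ (EFin \o E).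
  apply/measurable_EFinP; apply: open_continuous_measurable_fun.
    exact: interval_open.
  by move=> x; rewrite inE; exact: cE.
(* Each term of the balanced norm splits into its [v0] part, absorbed by [2 E], and its layer part,
   at most [2 Y^2]; the three layer parts give [6 Y^2]. *)
have sq2 (s t : R) : (s + t) ^+ 2 <= 2 * s ^+ 2 + 2 * t ^+ 2.
  by have := sqr_ge0 (s - t); rewrite !expr2; lra.
have pw x : x \in `]a, b[ ->
    v x ^+ 2 + (eps * v1 x) ^+ 2 + (eps ^+ 2 * v2 x) ^+ 2 <= 2 * E x + 6 * Y ^+ 2.
  move=> xab; have [hy0 hy1] := hy x (ooc x xab).
  have Y0 : 0 <= Y by exact: le_trans hy0.
  have s0 : y x ^+ 2 <= Y ^+ 2.
    by rewrite -(real_normK (num_real (y x))) lerXn2r// nnegrE.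
  have s1 : (eps * y1 x) ^+ 2 <= Y ^+ 2.
    by rewrite -(real_normK (num_real (eps * y1 x))) lerXn2r// nnegrE.
  have t0 := sq2 (v0 x) (y x).
  have t1 := sq2 (eps * v01 x) (eps * y1 x).
  have t2 := sq2 (v0 x - g x) (y x).
  have r0 : v0 x + y x = v x by rewrite /v0 subrK.
  have r1 : eps * v01 x + eps * y1 x = eps * v1 x by rewrite /v01; ring.
  have r2 : v0 x - g x + y x = eps ^+ 2 * v2 x.
    by rewrite /v0 /g /v /v2; field.
  rewrite r0 in t0; rewrite r1 in t1; rewrite r2 in t2.
  rewrite /E /energy_density.
  rewrite [(eps * v01 x) ^+ 2]exprMn in t1.
  have k0 : 0 <= eps ^+ 2 * v01 x ^+ 2 by rewrite mulr_ge0 ?sqr_ge0.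
  rewrite (_ : 2 * eps ^+ 2 * v01 x ^+ 2 = 2 * (eps ^+ 2 * v01 x ^+ 2));
    last by ring.
  clear - t0 t1 t2 s0 s1 k0; lra.
apply: (@le_trans _ _ (\int[lebesgue_measure]_(x in `]a, b[)
    (2%:E * (E x)%:E + (6 * Y ^+ 2)%:E))%E).
  apply: ge0_le_integral => //.
  - by move=> x _; rewrite lee_fin !addr_ge0 ?sqr_ge0.
  - apply/measurable_EFinP; apply: open_continuous_measurable_fun.
      exact: interval_open.
    move=> x; rewrite inE => xab.
    have c1 : {for x, continuous (fun t => eps * v1 t)}.
      exact: (continuousM (@cst_continuous _ _ eps x) (cv1 x xab)).
    have c2 : {for x, continuous (fun t => eps ^+ 2 * v2 t)}.
      exact: (continuousM (@cst_continuous _ _ (eps ^+ 2) x) (cv2 x xab)).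
    exact: (continuousD (continuousD (continuous_sqr (cv x xab))
      (continuous_sqr c1)) (continuous_sqr c2)).
  - apply: emeasurable_funD; last exact: measurable_cst.
    exact: measurable_funeM.
rewrite ge0_integralD//; last 3 first.
- by move=> x _; rewrite -EFinM lee_fin mulr_ge0.
- exact: measurable_funeM.
- by move=> x _; rewrite lee_fin mulr_ge0 ?sqr_ge0.
rewrite ge0_integralZl_EFin//; last by move=> x _; rewrite lee_fin.
have -> : (\int[lebesgue_measure]_(x in `]a, b[) (6 * Y ^+ 2)%:E =
    (6 * Y ^+ 2 * (b - a))%:E :> \bar R)%E.
  by rewrite integral_cst//= lebesgue_measure_itv /= lte_fin ab -EFinB -EFinM.
pose G := (\int[lebesgue_measure]_(x in `]a, b[) ((g x ^+ 2)%R)%:E)%E.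
have -> : residual a b alpha beta eps f (horner z) =
    (G + ((z.[a] - alpha) ^+ 2 + (z.[b] - beta) ^+ 2)%:E)%E by exact: residualE.
rewrite -/G in hE.
have G0 : (0 <= G)%E by apply: integral_ge0 => x _; rewrite lee_fin sqr_ge0.
set K := 1 + (b - a)^-1 in Y hy pw *.
have K0 : 0 <= K ^+ 2 * (b - a) by rewrite mulr_ge0 ?sqr_ge0// ltW.
have -> : (z.[a] - alpha) ^+ 2 = v a ^+ 2 by rewrite /v Ua.
have -> : (z.[b] - beta) ^+ 2 = v b ^+ 2 by rewrite /v Ub.
have vv0 : 0 <= v a ^+ 2 + v b ^+ 2 by rewrite addr_ge0 ?sqr_ge0.
rewrite [leRHS]ge0_muleDr ?lee_fin//.
apply: leeD.
  apply: (@le_trans _ _ (2%:E * G)%E); first by rewrite lee_wpmul2l// lee_fin.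
  by rewrite lee_wpmul2r// lee_fin lerDl -mulrA mulr_ge0.
rewrite -EFinM lee_fin.
(* As [Y = 2 K (|v a| + |v b|)], its square costs 4 times 2; with the factor 6 this is the 48 of the
   statement. *)
have hY : Y ^+ 2 <= 8 * K ^+ 2 * (v a ^+ 2 + v b ^+ 2).
  have := sq2 `|v a| `|v b|; rewrite !real_normK ?num_real// => h.
  rewrite /Y exprMn exprMn.
  have := ler_wpM2l (sqr_ge0 K) h; lra.
have := ler_wpM2r (ltW L0) hY; set s := v a ^+ 2 + v b ^+ 2.
have s0 : 0 <= s by rewrite addr_ge0 ?sqr_ge0.
lra.
Qed.

Unset Implicit Arguments.

Theorem theorem5p1 (R : realType) (a b : R) (hab : a < b) (alpha beta : R)
    (f : R -> R) (hf : analytic_on `[a, b] f) :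
  exists C : R, forall (eps : R) (U : R -> R) (W : nat) (z : {poly R}),
    0 < eps -> eps <= 1 ->
    exact_solution a b alpha beta eps f U ->
    (2 <= W)%N ->
    minimizes_residual a b alpha beta eps f W z ->
    expR 1 / (2 * eps) < W%:R + 1 / 2 ->
    (norm2eps_sq a b eps (fun x => (z.[x] - U x)%R)
       <= (C * (Num.sqrt (ln W%:R) / W%:R))%:E)%E.
Proof.
have [C C0 hC] := residual_upper_bound alpha beta hab hf.
pose K := 2 + 48 * (1 + (b - a)^-1) ^+ 2 * (b - a).
have K0 : 0 <= K.
  by rewrite addr_ge0// mulr_ge0 ?subr_ge0 ?(ltW hab)// mulr_ge0// sqr_ge0.
have l2 : 0 < Num.sqrt (ln 2 : R) by rewrite sqrtr_gt0 ln_gt0// ltr1n.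
(* Stability and minimality give [K C / W]; for [W >= 2] the ratio of [sqrt (ln W)] to [sqrt (ln 2)]
   is at least 1, so the required form follows. *)
exists (K * C / Num.sqrt (ln 2)) => eps U W z e0 e1 hU W2 [zW zmin] _.
have -> : W = (W - 2).+2 by lia.
have [p [zp hp]] := hC eps U (W - 2)%N e0 e1 hU.
apply: le_trans (stability z hab hf e0 e1 hU) _.
have pW : poly_space W p by rewrite /poly_space /=; apply: leq_trans zp _; lia.
have := le_trans (zmin p pW) hp.
set n := (W - 2).+2 => hz.
apply: (@le_trans _ _ (K%:E * (C / n%:R)%:E)%E); first by rewrite lee_wpmul2l// lee_fin.
rewrite -EFinM lee_fin.
have -> : K * C / Num.sqrt (ln 2) * (Num.sqrt (ln n%:R) / n%:R) =
    K * (C / n%:R) * (Num.sqrt (ln n%:R) / Num.sqrt (ln 2)).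
  by field; rewrite lt0r_neq0 ?pnatr_eq0.
rewrite ler_peMr//; first by rewrite mulr_ge0// divr_ge0.
rewrite ler_pdivlMr// mul1r ler_wsqrtr// ler_ln ?posrE ?ltr0n//.
by rewrite ler_nat.
Qed.
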